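(* Let $1<p<\infty$, and suppose that $f\in H^p$ satisfies $f(0)\neq 0$. If $\lambda = q_{0,p}[f]$, then \[ |\lambda|^{r-1} \leq \frac{r|f(0)|}{K_1\|f-f(0)\|_p^r + K_1\|f\|_p^r}, \] where $r$ and $K_1$ are the lower Pythagorean parameters.
   Context: $H^p$ denotes the classical Hardy space of holomorphic functions on the open unit disk $\mathbb{D}$, with norm $\|f\|_p = \left(\sup_{0\le \rho<1}\frac{1}{2\pi}\int_0^{2\pi}|f(\rho e^{i\theta})|^p\,d\theta\right)^{1/p}$. For an integer $n\ge 0$ let $\mathcal{P}_n$ be the set of complex polynomials of degree at most $n$. For $1<p<\infty$ and $f\in H^p$, not identically zero, the $n$-th optimal polynomial approximant (OPA) to $1/f$ in $H^p$, denoted $q_{n,p}[f]$, is the unique polynomial $q\in\mathcal{P}_n$ minimizing $\|1-qf\|_p$ over $\mathcal{P}_n$; in particular $q_{0,p}[f]$ is a complex constant. The lower Pythagorean parameters are: $r=2$, $K_1=p-1$ if $1<p\le 2$; and $r=p$, $K_1=\frac{1}{2^{p-1}-1}$ if $2\le p<\infty$. (They are the parameters for which $\|x+y\|_p^r\ge \|x\|_p^r+K_1\|y\|_p^r$ whenever $x\perp_p y$ in $L^p$, where $x\perp_p y$ means $\|x+\beta y\|_p\ge\|x\|_p$ for all scalars $\beta$.) *)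

(* Defs.v *)
From HB Require Import structures.
From mathcomp Require Import all_boot all_order all_algebra.
From mathcomp Require Import all_classical all_reals all_analysis.
From mathcomp Require Export complex.
Import Order.TTheory GRing.Theory Num.Theory.
Import numFieldNormedType.Exports.

Set Implicit Arguments.
Unset Strict Implicit.
Unset Printing Implicit Defensive.

Local Open Scope classical_set_scope.
Local Open Scope ring_scope.
Local Open Scope complex_scope.

Definition cis (R : realType) (theta : R) : R[i] := cos theta +i* sin theta.

(* Functions on the open unit disk are total functions R[i] -> R[i] whose
   values outside the disk are never used. Differentiability is over the
   scalar field R[i], hence complex differentiability. *)
Definition holomorphic_on_disk (R : realType) (f : R[i] -> R[i]) : Prop :=
  forall z : R[i], `|z| < 1 -> derivable (f : R[i]^o -> R[i]^o) z 1.

(* Normc.normc z is the modulus of z as an element of R; `|z| is the same number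
   seen in R[i]. *)
Definition integral_mean (R : realType) (p : R) (f : R[i] -> R[i]) (rho : R)
    : \bar R :=
  (((2 * pi)^-1)%:E *
  \int[lebesgue_measure]_(theta in `[0%R, (2 * pi)%R])
     ((Normc.normc (f (rho%:C * cis theta))) `^ p)%:E)%E.

Definition ehardy_norm (R : realType) (p : R) (f : R[i] -> R[i]) : \bar R :=
  poweR (ereal_sup [set integral_mean p f rho | rho in `[0, 1[]) p^-1.

Definition hardy_space (R : realType) (p : R) : set (R[i] -> R[i]) :=
  [set f | holomorphic_on_disk f /\ (ehardy_norm p f < +oo)%E].

Definition hardy_norm (R : realType) (p : R) (f : R[i] -> R[i]) : R :=
  fine (ehardy_norm p f).

(* Degree at most n; recall that size is degree plus one. *)
Definition polys_upto (R : realType) (n : nat) : set {poly R[i]} :=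
  [set q | (size q <= n.+1)%N].

Definition opa_error (R : realType) (p : R) (f : R[i] -> R[i])
    (q : {poly R[i]}) : \bar R :=
  ehardy_norm p (fun z => 1 - q.[z] * f z).

(* Uniqueness of the minimizer is a consequence of strict convexity for
   1 < p < oo and f != 0, hence not part of the definition. *)
Definition is_opa (R : realType) (n : nat) (p : R) (f : R[i] -> R[i])
    (q : {poly R[i]}) : Prop :=
  polys_upto n q /\
  forall g : {poly R[i]}, polys_upto n g ->
    (opa_error p f q <= opa_error p f g)%E.

Definition lower_r (R : realType) (p : R) : R := if p <= 2 then 2 else p.

Definition lower_K1 (R : realType) (p : R) : R :=
  if p <= 2 then p - 1 else (2 `^ (p - 1) - 1)^-1.

(* Main.v *)
Require Import Defs.
From HB Require Import structures.
From mathcomp Require Import all_boot all_order all_algebra.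
From mathcomp Require Import all_classical all_reals all_analysis.
From mathcomp Require Import complex.
From mathcomp Require Import ring lra.
Import Order.TTheory GRing.Theory Num.Theory.
Import numFieldNormedType.Exports.
Local Open Scope classical_set_scope.
Local Open Scope ring_scope.
Local Open Scope complex_scope.

Set Implicit Arguments.
Unset Strict Implicit.
Unset Printing Implicit Defensive.

(**
  Write ||.|| for the H^p norm and r, K1 for the lower Pythagorean parameters.
  The constant lambda minimises ||1 - mu f||, so 1 - lambda f is orthogonal to
  f, and 1 = (1 - lambda f) + lambda f gives
      1 >= ||1 - lambda f||^r + K1 |lambda|^r ||f||^r.
  A constant is orthogonal to every function vanishing at 0, because the
  circular mean of radius 0 already sees the constant, and
  1 - lambda f = (1 - lambda f(0)) - lambda (f - f(0)) gives
      ||1 - lambda f||^r >= |1 - lambda f(0)|^r + K1 |lambda|^r ||f - f(0)||^r.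
  Adding the two and using Bernoulli, 1 - |1 - lambda f(0)|^r <= r |lambda f(0)|,
  yields the bound ([pythagorean_bound]).

  The Pythagorean inequality ([hardy_pythagoras]) follows by repeated halving
  ([pythagoras_of_parallelogram]) from the weak parallelogram law
      2 (||u||^r + C ||v||^r) <= ||u + v||^r + ||u - v||^r,
  where C = 1 for p >= 2 and C = p - 1 for p <= 2.  On a fixed circle this law
  ([mean_parallelogram]) is a matter of L^p: Clarkson's inequality for p >= 2;
  for p <= 2 the two-point inequality ([two_point_complex]) followed by the
  reverse Minkowski inequality in L^{p/2} ([powR_add_support]).

  The H^p norm is a supremum over circles and the law involves two norms on its
  small side, so passing to the supremum requires the circular means to be
  nondecreasing in the radius ([circ_mean_le]).  This is the place where
  holomorphy enters.  The power |h|^p is convex in h, so at an interior maximum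
  of the average of |h|^p over the rotations by roots of unity, perturbed by
  e |z|^2, supporting functionals of the convex function produce a holomorphic G
  that vanishes at the maximum and has negative real part on a circle around it
  ([orbit_sum_max]).  The mean value property forbids this
  ([no_negative_circle]); it comes from Goursat's theorem on rectangles
  ([goursat_rectangle]) in logarithmic coordinates, where a circle becomes a
  vertical segment and the two horizontal sides cancel by periodicity.
  Averages over rotations are Riemann sums of the circular means, hence the
  monotonicity.
*)

(** * Modulus of complex numbers *)

Local Notation nc := Normc.normc.

Section Modulus.
Context {R : realType}.
Implicit Types (z w : R[i]) (x y : R).

Lemma ncE z : nc z = Num.sqrt (complex.Re z ^+ 2 + complex.Im z ^+ 2).
Proof. by case: z. Qed.

Lemma nc_ge0 z : 0 <= nc z. Proof. by rewrite ncE sqrtr_ge0. Qed.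

Lemma nc_sqr z : nc z ^+ 2 = complex.Re z ^+ 2 + complex.Im z ^+ 2.
Proof. by rewrite ncE sqr_sqrtr// addr_ge0 ?sqr_ge0. Qed.

Lemma norm_nc z : `|z| = (nc z)%:C. Proof. by []. Qed.

Lemma nc_add z w : nc (z + w) <= nc z + nc w.
Proof. exact: le_normcD. Qed.

Lemma ncM z w : nc (z * w) = nc z * nc w. Proof. exact: Normc.normcM. Qed.

Lemma nc_opp z : nc (- z) = nc z. Proof. exact: normcN. Qed.

Lemma nc_subC z w : nc (z - w) = nc (w - z).
Proof. by rewrite -nc_opp opprB. Qed.

Lemma nc_real x : nc x%:C = `|x|.
Proof. by rewrite ncE/= expr0n/= addr0 sqrtr_sqr. Qed.

Lemma nc0 : nc (0 : R[i]) = 0. Proof. exact: Normc.normc0. Qed.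
Lemma nc1 : nc (1 : R[i]) = 1. Proof. exact: Normc.normc1. Qed.

Lemma nc_eq0 z : (nc z == 0) = (z == 0).
Proof.
by apply/eqP/eqP => [/Normc.eq0_normc|->]; rewrite ?nc0.
Qed.

Lemma nc_gt0 z : (0 < nc z) = (z != 0).
Proof. by rewrite lt0r nc_ge0 andbT nc_eq0. Qed.

Lemma Re_add z w : complex.Re (z + w) = complex.Re z + complex.Re w.
Proof. by case: z; case: w. Qed.
Lemma Im_add z w : complex.Im (z + w) = complex.Im z + complex.Im w.
Proof. by case: z; case: w. Qed.
Lemma Re_opp z : complex.Re (- z) = - complex.Re z.
Proof. by case: z. Qed.
Lemma Im_opp z : complex.Im (- z) = - complex.Im z.
Proof. by case: z. Qed.
Lemma Re_mul z w : complex.Re (z * w) =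
  complex.Re z * complex.Re w - complex.Im z * complex.Im w.
Proof. by case: z; case: w. Qed.
Lemma Im_mul z w : complex.Im (z * w) =
  complex.Re z * complex.Im w + complex.Im z * complex.Re w.
Proof. by case: z; case: w. Qed.

Lemma Re_le_nc z : `|complex.Re z| <= nc z.
Proof. by rewrite ncE -sqrtr_sqr ler_wsqrtr// lerDl sqr_ge0. Qed.

Lemma Im_le_nc z : `|complex.Im z| <= nc z.
Proof. by rewrite ncE -sqrtr_sqr ler_wsqrtr// lerDr sqr_ge0. Qed.

Lemma nc_le_ReIm z : nc z <= `|complex.Re z| + `|complex.Im z|.
Proof.
rewrite -(@ler_pXn2r _ 2)// ?nnegrE ?nc_ge0 ?addr_ge0// nc_sqr.
rewrite -[in leLHS]real_normK ?num_real// -[X in _ + X]real_normK ?num_real//.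
have := normr_ge0 (complex.Re z); have := normr_ge0 (complex.Im z); nra.
Qed.

Lemma nc_dist z w : `|nc z - nc w| <= nc (z - w).
Proof.
have h1 := nc_add (z - w) w; have h2 := nc_add (w - z) z.
rewrite ler_norml; rewrite !subrK in h1 h2; rewrite nc_subC in h2.
by apply/andP; split; lra.
Qed.

Lemma nc_cis x : nc (cis x) = 1.
Proof. by rewrite ncE/= cos2Dsin2 sqrtr1. Qed.

Lemma cis0 : cis (0 : R) = 1.
Proof. by rewrite /cis cos0 sin0. Qed.

Lemma cisD x y : cis (x + y) = cis x * cis y.
Proof.
apply/eqP; rewrite eq_complex /= cosD sinD; apply/andP; split; apply/eqP => //.
by rewrite addrC.
Qed.

End Modulus.

(** * Complex derivatives and the exponential *)

Section ComplexDerivative.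
Context {R : realType}.
Implicit Types (f g : R[i] -> R[i]) (z w d : R[i]).

(** Complex differentiability at a point, with the error measured by real
    numbers so that real arithmetic applies to it. *)
Definition cdiff f z d := forall e : R, 0 < e -> exists2 t : R, 0 < t &
  forall h, nc h < t -> nc (f (z + h) - f z - d * h) <= e * nc h.

Definition ccont f z := forall e : R, 0 < e -> exists2 t : R, 0 < t &
  forall h, nc h < t -> nc (f (z + h) - f z) < e.

(** Only pointwise existence of the derivative is available: nothing is known
    about its continuity, hence the need for Goursat's argument below. *)
Lemma derivable_cdiff f z :
  derivable (f : R[i]^o -> R[i]^o) z 1 -> exists d, cdiff f z d.
Proof.
move=> /cvg_ex[/= l /cvgrPdist_le fl]; exists l => e e0.
have /fl : (0 : R[i]) < e%:C by rewrite ltcR.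
rewrite near_withinE => /nbhs_ballP[t/= t0 tP].
have t_real : t = (complex.Re t)%:C.
  by move: t0; rewrite ltcE/= => /andP[/eqP it _]; case: (t) it => a b /= ->.
exists (complex.Re t); first by move: t0; rewrite t_real ltcR.
move=> h ht; have [->|h0] := eqVneq h 0.
  by rewrite addr0 subrr mulr0 subr0 nc0 mulr0.
have /tP/(_ h0) : ball (0 : R[i]^o) t h.
  by rewrite /ball/= sub0r normrN t_real norm_nc ltcR.
rewrite norm_nc lecR /=.
set D := (X in nc (l - X)).
have -> : f (z + h) - f z - l * h = (D - l) * h.
  rewrite /D mulrBl; congr (_ - _).
  have -> : h *: (1 : R[i]^o) = h by rewrite /GRing.scale/= mulr1.
  by rewrite [h + z]addrC [_ *: _]/GRing.scale/= mulrAC mulVf// mul1r.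
by move=> Dl; rewrite ncM ler_wpM2r ?nc_ge0// nc_subC.
Qed.

Lemma cdiff_cont f z d : cdiff f z d -> ccont f z.
Proof.
move=> fd e e0; have [t t0 tP] := fd 1 ltr01.
have D0 := nc_ge0 d.
exists (Num.min t (e / (2 + nc d))).
  by rewrite lt_min t0 divr_gt0// ltr_wpDr.
move=> h; rewrite lt_min => /andP[/tP ht]; rewrite ltr_pdivlMr; last by lra.
move=> he; have := nc_add (f (z + h) - f z - d * h) (d * h).
by rewrite subrK ncM; have := nc_ge0 h; nra.
Qed.

Lemma cdiff_cst c z : cdiff (fun=> c) z 0.
Proof.
move=> e e0; exists 1 => // h _.
by rewrite subrr mul0r subr0 nc0 mulr_ge0 ?nc_ge0// ltW.
Qed.

Lemma cdiffD f g z a b : cdiff f z a -> cdiff g z b ->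
  cdiff (fun w => f w + g w) z (a + b).
Proof.
move=> fa gb e e0; have e2 : 0 < e / 2 by rewrite divr_gt0.
have [t t0 tP] := fa _ e2; have [s s0 sP] := gb _ e2.
exists (Num.min t s); first by rewrite lt_min t0.
move=> h; rewrite lt_min => /andP[/tP th /sP sh].
have -> : f (z + h) + g (z + h) - (f z + g z) - (a + b) * h =
  (f (z + h) - f z - a * h) + (g (z + h) - g z - b * h) by ring.
by apply: le_trans (nc_add _ _) _; lra.
Qed.

Lemma cdiff_comp f g z a b : cdiff f z a -> cdiff g (f z) b ->
  cdiff (g \o f) z (b * a).
Proof.
move=> fa gb e e0; set A := nc a; set B := nc b.
have A0 : 0 <= A := nc_ge0 _; have B0 : 0 <= B := nc_ge0 _.
have [t t0 tP] := fa 1 ltr01.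
have e1 : 0 < e / (2 * (A + 1)) by rewrite divr_gt0// mulr_gt0//; lra.
have e2 : 0 < e / (2 * (B + 1)) by rewrite divr_gt0// mulr_gt0//; lra.
have [s s0 sP] := gb _ e1; have [r r0 rP] := fa _ e2.
exists (Num.min (Num.min t r) (s / (A + 1))).
  by rewrite !lt_min t0 r0 divr_gt0//; lra.
move=> h; rewrite !lt_min => /andP[/andP[/tP th /rP rh]].
rewrite ltr_pdivlMr; last by lra.
move=> hs; have H0 := nc_ge0 h.
set k := f (z + h) - f z.
have kle : nc k <= (A + 1) * nc h.
  have := nc_add (k - a * h) (a * h); rewrite subrK ncM -/A.
  by move: th; rewrite -/k mul1r; lra.
have /sP : nc k < s by apply: le_lt_trans kle _; lra.
have -> /= : f z + k = f (z + h) by rewrite /k addrC subrK.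
move=> sk; have -> : g (f (z + h)) - g (f z) - b * a * h =
  (g (f (z + h)) - g (f z) - b * k) + b * (k - a * h) by ring.
apply: le_trans (nc_add _ _) _; rewrite ncM -/B.
have h1 : nc (g (f (z + h)) - g (f z) - b * k) <= e / 2 * nc h.
  apply: le_trans sk _; apply: le_trans (ler_wpM2l (ltW e1) kle) _.
  rewrite le_eqVlt; apply/orP; left; apply/eqP; field; lra.
have h2 : B * nc (k - a * h) <= e / 2 * nc h.
  apply: (@le_trans _ _ ((B + 1) * (e / (2 * (B + 1)) * nc h))).
    by apply: ler_pM; rewrite ?nc_ge0//; lra.
  rewrite le_eqVlt; apply/orP; left; apply/eqP; field; lra.
lra.
Qed.

Lemma cdiff_eq f g z d : f =1 g -> cdiff f z d -> cdiff g z d.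
Proof. by move=> /funext ->. Qed.

Lemma cdiff_affine a b z : cdiff (fun w => a + b * w) z b.
Proof.
move=> e e0; exists 1 => // h _.
have -> : a + b * (z + h) - (a + b * z) - b * h = 0 by ring.
by rewrite nc0 mulr_ge0 ?nc_ge0// ltW.
Qed.

Lemma cdiffZ c f z d : cdiff f z d -> cdiff (fun w => c * f w) z (c * d).
Proof.
move=> fd; apply: (@cdiff_eq ((fun w => 0 + c * w) \o f)).
  by move=> w /=; rewrite add0r.
by apply: cdiff_comp fd _; apply: cdiff_affine.
Qed.

Lemma cdiff_sum (I : Type) (s : seq I) (F : I -> R[i] -> R[i]) z :
  (forall i, exists d, cdiff (F i) z d) ->
  exists d, cdiff (fun w => \sum_(i <- s) F i w) z d.
Proof.
move=> Fd; elim: s => [|i s [d IH]].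
  exists 0; apply: (@cdiff_eq (fun=> 0)); last exact: cdiff_cst.
  by move=> w; rewrite big_nil.
have [di Fi] := Fd i; exists (di + d).
by apply: (cdiff_eq _ (cdiffD Fi IH)) => w; rewrite big_cons.
Qed.

Definition cexp w : R[i] := (expR (complex.Re w))%:C * cis (complex.Im w).

Lemma cexpD z w : cexp (z + w) = cexp z * cexp w.
Proof. by rewrite /cexp Re_add Im_add expRD cisD rmorphM/=; ring. Qed.

Lemma nc_cexp w : nc (cexp w) = expR (complex.Re w).
Proof. by rewrite /cexp ncM nc_cis mulr1 nc_real ger0_norm// expR_ge0. Qed.

Lemma is_derive_epsilon (f : R -> R) (x l : R) : is_derive x 1 f l ->
  forall e : R, 0 < e -> exists2 t : R, 0 < t &
  forall h, `|h| < t -> `|f (x + h) - f x - l * h| <= e * `|h|.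
Proof.
move=> [] /cvg_ex[/= m fm] fl.
have ml : m = l by rewrite -fl; apply/esym/cvg_lim.
rewrite {}ml in fm.
move=> e e0; move/cvgrPdist_le : fm => /(_ _ e0).
rewrite near_withinE => /nbhs_ballP[t/= t0 tP].
exists t => // h ht; have [->|h0] := eqVneq h 0.
  by rewrite addr0 subrr mulr0 subr0 normr0 mulr0.
have /tP/(_ h0) : ball (0 : R^o) t h by rewrite /ball/= sub0r normrN.
set D := (X in `|l - X|) => Dl.
have -> : f (x + h) - f x - l * h = (D - l) * h.
  rewrite /D mulrBl; congr (_ - _).
  have -> : h *: (1 : R^o) = h by rewrite /GRing.scale/= mulr1.
  by rewrite [h + x]addrC [_ *: _]/GRing.scale/= mulrAC mulVf// mul1r.
by rewrite normrM ler_wpM2r// distrC.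
Qed.

Lemma cdiff_cexp0 : cdiff cexp 0 1.
Proof.
move=> e e0; set u := Num.min (e / 8) 1.
have u0 : 0 < u by rewrite lt_min ltr01 andbT divr_gt0.
have u1 : u <= 1 by rewrite ge_min lexx orbT.
have ue : u <= e / 8 by rewrite ge_min lexx.
clearbody u.
have [t1 t10 t1P] := is_derive_epsilon (is_derive_expR (0 : R)) u0.
have [t2 t20 t2P] := is_derive_epsilon (is_derive_cos (0 : R)) u0.
have [t3 t30 t3P] := is_derive_epsilon (is_derive_sin (0 : R)) u0.
exists (Num.min (Num.min t1 t2) (Num.min t3 u)).
  by rewrite !lt_min t10 t20 t30 u0.
move=> h; rewrite !lt_min => /andP[/andP[h1 h2] /andP[h3 h4]].
have ha := Re_le_nc h; have hb := Im_le_nc h.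
have ce0 : cexp 0 = 1 by rewrite /cexp /= expR0 cis0 mulr1.
rewrite add0r mul1r ce0.
have [a [b hE]] : exists a b, h = a +i* b by case: h {h1 h2 h3 h4 ha hb} => a b; exists a, b.
move: h1 h2 h3 h4 ha hb; set H := nc h => h1 h2 h3 h4.
rewrite {1 2}hE /= => ha hb.
have := t1P a (le_lt_trans ha h1); rewrite add0r expR0 mul1r.
have := t2P b (le_lt_trans hb h2); rewrite add0r cos0 sin0 oppr0 mul0r subr0.
have := t3P b (le_lt_trans hb h3); rewrite add0r cos0 sin0 subr0 mul1r.
set E := expR a; set C := cos b; set S := sin b => hS hC hE1.
apply: le_trans (nc_le_ReIm _) _; rewrite hE /cexp /= -/E -/C -/S.
rewrite !mul0r !subr0 addr0.
have -> : E * C - 1 - a = (E - 1 - a) * C + (1 + a) * (C - 1) by ring.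
have -> : E * S - b = (E - 1 - a) * S + (1 + a) * (S - b) + a * b by ring.
have C1 : `|C| <= 1 by rewrite ler_norml cos_geN1 cos_le1.
have S1 : `|S| <= 1 by rewrite ler_norml sin_geN1 sin_le1.
have H0 : 0 <= H := nc_ge0 _.
have a1 : `|1 + a| <= 2.
  by apply: le_trans (ler_normD _ _) _; rewrite normr1; lra.
have k1 : `|(E - 1 - a) * C| <= u * H.
  by rewrite normrM; have := normr_ge0 (E - 1 - a); have := normr_ge0 C; nra.
have k2 : `|(1 + a) * (C - 1)| <= 2 * (u * H).
  by rewrite normrM; have := normr_ge0 (1 + a); have := normr_ge0 (C - 1); nra.
have k3 : `|(E - 1 - a) * S| <= u * H.
  by rewrite normrM; have := normr_ge0 (E - 1 - a); have := normr_ge0 S; nra.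
have k4 : `|(1 + a) * (S - b)| <= 2 * (u * H).
  by rewrite normrM; have := normr_ge0 (1 + a); have := normr_ge0 (S - b); nra.
have k5 : `|a * b| <= u * H.
  by rewrite normrM; have := normr_ge0 a; have := normr_ge0 b; nra.
have l1 := ler_normD ((E - 1 - a) * C) ((1 + a) * (C - 1)).
have l2 := ler_normD ((E - 1 - a) * S + (1 + a) * (S - b)) (a * b).
have l3 := ler_normD ((E - 1 - a) * S) ((1 + a) * (S - b)).
have : 7 * (u * H) <= e * H by nra.
lra.
Qed.

(** The functional equation transports the derivative at 0 to any point. *)
Lemma cdiff_cexp w : cdiff cexp w (cexp w).
Proof.
move=> e e0; set A := nc (cexp w).
have A0 : 0 < A by rewrite /A nc_cexp expR_gt0.
have [t t0 tP] := cdiff_cexp0 (divr_gt0 e0 A0).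
exists t => // h /tP; rewrite add0r mul1r.
have -> : cexp 0 = 1 by rewrite /cexp /= expR0 cis0 mulr1.
move=> hh; rewrite cexpD.
have -> : cexp w * cexp h - cexp w - cexp w * h = cexp w * (cexp h - 1 - h) by ring.
rewrite ncM -/A; apply: le_trans (ler_wpM2l (ltW A0) hh) _.
by rewrite mulrA mulrCA divff ?mulr1// gt_eqF.
Qed.

End ComplexDerivative.

(** * Integrals over segments *)

Section SegmentIntegral.
Context {R : realType}.
Implicit Types (a b c m : R) (f g : R -> R).

Definition segint a b f : R := \int[lebesgue_measure]_(x in `[a, b]) f x.

Definition segcont a b f := forall x, a <= x <= b -> {for x, continuous f}.

Lemma segcont_integrable a b f : segcont a b f ->
  lebesgue_measure.-integrable `[a, b] (EFin \o f).
Proof.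
move=> fc; apply: continuous_compact_integrable; first exact: segment_compact.
apply: continuous_in_subspaceT => x; rewrite inE/= in_itv/= => xab.
exact: fc.
Qed.

Lemma segint_split a m b f : a <= m -> m <= b -> segcont a b f ->
  segint a b f = segint a m f + segint m b f.
Proof.
move=> am mb fc; rewrite /segint.
have h := @Rintegral_itvB R f (BLeft a) (BRight b) m (segcont_integrable fc).
move: h; rewrite !bnd_simp => /(_ am mb).
rewrite Rintegral_itv_obnd_cbnd; first by move=> <-; rewrite addrC subrK.
apply: (integrableS _ _ _ (segcont_integrable fc)) => //.
by apply: subset_itv; rewrite bnd_simp.
Qed.

Lemma segint_add a b f g : segcont a b f -> segcont a b g ->
  segint a b (fun x => f x + g x) = segint a b f + segint a b g.
Proof. by move=> fc gc; apply: RintegralD => //; exact: segcont_integrable. Qed.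

Lemma segintZ a b k f : segcont a b f -> segint a b (fun x => k * f x) = k * segint a b f.
Proof. by move=> fc; apply: RintegralZl => //; exact: segcont_integrable. Qed.

Lemma segint_cst a b c : a <= b -> segint a b (fun=> c) = c * (b - a).
Proof.
move=> ab; rewrite /segint Rintegral_cst//= lebesgue_measure_itv/= lte_fin.
have [ab'|ba] := ltP a b; first by rewrite -EFinB.
by have -> : a = b; [lra|rewrite subrr].
Qed.

Lemma eq_segint a b f g : (forall x, a <= x <= b -> f x = g x) -> segint a b f = segint a b g.
Proof.
by move=> fg; apply: eq_Rintegral => x; rewrite inE/= in_itv/= => /fg.
Qed.

Lemma segint_le a b f g : segcont a b f -> segcont a b g ->
  (forall x, a <= x <= b -> f x <= g x) -> segint a b f <= segint a b g.
Proof.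
move=> fc gc fg; apply: le_Rintegral => //; try exact: segcont_integrable.
Qed.

Lemma segcont_cst a b c : segcont a b (fun=> c).
Proof. by move=> x _; exact: cvg_cst. Qed.

Lemma segint_near a b f c e : a <= b -> segcont a b f ->
  (forall x, a <= x <= b -> `|f x - c| <= e) ->
  `|segint a b f - c * (b - a)| <= e * (b - a).
Proof.
move=> ab fc fe; have cc k := @segcont_cst a b k.
have := segint_le (cc (c - e)) fc; have := segint_le fc (cc (c + e)).
rewrite !segint_cst// => h1 h2; rewrite ler_distl.
apply/andP; split; [rewrite -mulrBl; apply: h2|rewrite -mulrDl; apply: h1].
- by move=> x /fe; rewrite ler_distl => /andP[].
- by move=> x /fe; rewrite ler_distl => /andP[].
Qed.

Lemma epsilon_continuous f x :
  (forall e : R, 0 < e -> exists2 t : R, 0 < t &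
    forall h, `|h| < t -> `|f (x + h) - f x| < e) -> {for x, continuous f}.
Proof.
move=> fx; apply/cvgrPdist_lt => e /fx[t t0 tP].
apply/nbhs_ballP; exists t => //= y; rewrite /ball/= distrC => /tP.
by rewrite (addrC x) subrK distrC.
Qed.

Lemma continuous_epsilon f x : {for x, continuous f} ->
  forall e : R, 0 < e -> exists2 t : R, 0 < t &
    forall h, `|h| < t -> `|f (x + h) - f x| < e.
Proof.
move=> /cvgrPdist_lt fx e /fx /nbhs_ballP[t/= t0 tP]; exists t => // h ht.
by rewrite distrC; apply: tP; rewrite /ball/= opprD addNKr normrN.
Qed.

Lemma nested_segments (u v : nat -> R) :
  (forall n, u n <= u n.+1) -> (forall n, v n.+1 <= v n) ->
  (forall n, u n <= v n) -> exists x, forall n, u n <= x <= v n.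
Proof.
move=> uS vS uv.
have um (m n : nat) : (m <= n)%N -> u m <= u n.
  by move=> /subnK <-; elim: (n - m)%N => // k IH; exact: le_trans IH (uS _).
have vm (m n : nat) : (m <= n)%N -> v n <= v m.
  by move=> /subnK <-; elim: (n - m)%N => // k IH; exact: le_trans (vS _) IH.
have ub n : ubound (range u) (v n).
  move=> _ [m _ <-]; apply: le_trans (um m (maxn m n) (leq_maxl _ _)) _.
  exact: le_trans (uv _) (vm _ _ (leq_maxr _ _)).
exists (sup (range u)) => n; apply/andP; split.
  apply: ub_le_sup; last by exists n.
  by exists (v 0%N); exact: ub.
by apply: ge_sup; [exists (u 0%N); exists 0%N | exact: ub].
Qed.

End SegmentIntegral.

(** * Goursat's theorem on rectangles and the mean value property *)

Section Goursat.
Context {R : realType}.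
Implicit Types (a b c d m x y : R) (g : R[i] -> R[i]) (z w : R[i]).

Definition holo_rect g a b c d := forall x y, a <= x <= b -> c <= y <= d ->
  exists D, cdiff g (x +i* y) D.

(** The imaginary part of the contour integral of [g] along the boundary of the
    rectangle, that is, the part in which vertical sides carry the real part of
    [g]. *)
Definition flux g a b c d : R :=
  segint c d (fun y => complex.Re (g (b +i* y) - g (a +i* y))) -
  segint a b (fun x => complex.Im (g (x +i* d) - g (x +i* c))).

Lemma holo_rectW g a b c d a' b' c' d' : holo_rect g a b c d ->
  a <= a' -> b' <= b -> c <= c' -> d' <= d -> holo_rect g a' b' c' d'.
Proof.
move=> gh aa bb cc dd x y /andP[ax xb] /andP[cy yd]; apply: gh.
- by rewrite (le_trans aa) ?(le_trans xb).
- by rewrite (le_trans cc) ?(le_trans yd).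
Qed.

Lemma continuous_vertical g x y : ccont g (x +i* y) ->
  {for y, continuous (fun t => complex.Re (g (x +i* t)))}.
Proof.
move=> gc; apply: epsilon_continuous => e /gc[t t0 tP]; exists t => // h ht.
have /tP : nc (0 +i* h) < t.
  by apply: le_lt_trans (nc_le_ReIm _) _; rewrite /= normr0 add0r.
apply: le_lt_trans; rewrite -Re_opp -Re_add.
have -> : x +i* (y + h) = (x +i* y) + (0 +i* h).
  by apply/eqP; rewrite eq_complex/= addr0 !eqxx.
exact: Re_le_nc.
Qed.

Lemma continuous_horizontal g x y : ccont g (x +i* y) ->
  {for x, continuous (fun t => complex.Im (g (t +i* y)))}.
Proof.
move=> gc; apply: epsilon_continuous => e /gc[t t0 tP]; exists t => // h ht.
have /tP : nc (h +i* 0) < t.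
  by apply: le_lt_trans (nc_le_ReIm _) _; rewrite /= normr0 addr0.
apply: le_lt_trans; rewrite -Im_opp -Im_add.
have -> : (x + h) +i* y = (x +i* y) + (h +i* 0).
  by apply/eqP; rewrite eq_complex/= addr0 !eqxx.
exact: Im_le_nc.
Qed.

Lemma segcont_Re_vertical g a b c d x : holo_rect g a b c d -> a <= x <= b ->
  segcont c d (fun y => complex.Re (g (x +i* y))).
Proof.
move=> gh xab y ycd; have [D gD] := gh _ _ xab ycd.
exact: continuous_vertical (cdiff_cont gD).
Qed.

Lemma segcont_Im_horizontal g a b c d y : holo_rect g a b c d -> c <= y <= d ->
  segcont a b (fun x => complex.Im (g (x +i* y))).
Proof.
move=> gh ycd x xab; have [D gD] := gh _ _ xab ycd.
exact: continuous_horizontal (cdiff_cont gD).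
Qed.

Lemma segcont_sub a b (f h : R -> R) : segcont a b f -> segcont a b h ->
  segcont a b (fun x => f x - h x).
Proof. by move=> fc hc x xab; apply: cvgB; [exact: fc|exact: hc]. Qed.

Lemma flux_vertical g a b c d : holo_rect g a b c d -> a <= b ->
  segcont c d (fun y => complex.Re (g (b +i* y) - g (a +i* y))).
Proof.
move=> gh ab.
rewrite (_ : (fun y => _) = (fun y => complex.Re (g (b +i* y)) -
    complex.Re (g (a +i* y)))); last by apply/funext => y; rewrite Re_add Re_opp.
by apply: segcont_sub; apply: segcont_Re_vertical gh _; rewrite ab lexx.
Qed.

Lemma flux_horizontal g a b c d : holo_rect g a b c d -> c <= d ->
  segcont a b (fun x => complex.Im (g (x +i* d) - g (x +i* c))).
Proof.
move=> gh cd.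
rewrite (_ : (fun x => _) = (fun x => complex.Im (g (x +i* d)) -
    complex.Im (g (x +i* c)))); last by apply/funext => y; rewrite Im_add Im_opp.
by apply: segcont_sub; apply: segcont_Im_horizontal gh _; rewrite cd lexx.
Qed.

Lemma flux_split_x g a m b c d : holo_rect g a b c d ->
  a <= m -> m <= b -> c <= d ->
  flux g a b c d = flux g a m c d + flux g m b c d.
Proof.
move=> gh am mb cd; have ab := le_trans am mb.
have h1 : holo_rect g a m c d by apply: holo_rectW gh _ _ _ _.
have h2 : holo_rect g m b c d by apply: holo_rectW gh _ _ _ _.
rewrite /flux (segint_split am mb (flux_horizontal gh cd)).
have -> : segint c d (fun y => complex.Re (g (b +i* y) - g (a +i* y))) =
  segint c d (fun y => complex.Re (g (m +i* y) - g (a +i* y))) +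
  segint c d (fun y => complex.Re (g (b +i* y) - g (m +i* y))).
  rewrite -segint_add; [|exact: flux_vertical h1 _|exact: flux_vertical h2 _].
  by apply: eq_segint => y _; rewrite !Re_add !Re_opp; ring.
ring.
Qed.

Lemma flux_split_y g a b c m d : holo_rect g a b c d ->
  c <= m -> m <= d -> a <= b ->
  flux g a b c d = flux g a b c m + flux g a b m d.
Proof.
move=> gh cm md ab; have cd := le_trans cm md.
have h1 : holo_rect g a b c m by apply: holo_rectW gh _ _ _ _.
have h2 : holo_rect g a b m d by apply: holo_rectW gh _ _ _ _.
rewrite /flux (segint_split cm md (flux_vertical gh ab)).
have -> : segint a b (fun x => complex.Im (g (x +i* d) - g (x +i* c))) =
  segint a b (fun x => complex.Im (g (x +i* m) - g (x +i* c))) +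
  segint a b (fun x => complex.Im (g (x +i* d) - g (x +i* m))).
  rewrite -segint_add; [|exact: flux_horizontal h1 _|exact: flux_horizontal h2 _].
  by apply: eq_segint => y _; rewrite !Im_add !Im_opp; ring.
ring.
Qed.

(** The flux of an affine function of slope [D] is
    (Re D - Re D) * (b - a) * (d - c) = 0, so only the error term counts. *)
Lemma flux_small g a b c d x0 y0 D (e : R) : holo_rect g a b c d ->
  a <= b -> c <= d ->
  (forall x y, a <= x <= b -> c <= y <= d ->
    nc (g (x +i* y) - g (x0 +i* y0) - D * ((x - x0) +i* (y - y0))) <= e) ->
  `|flux g a b c d| <= 2 * e * ((b - a) + (d - c)).
Proof.
move=> gh ab cd ge.
set E := fun x y => g (x +i* y) - g (x0 +i* y0) - D * ((x - x0) +i* (y - y0)).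
have EP x y x' y' : g (x +i* y) - g (x' +i* y') =
    (E x y - E x' y') + D * ((x - x') +i* (y - y')).
  have -> : (x - x') +i* (y - y') =
      ((x - x0) +i* (y - y0)) - ((x' - x0) +i* (y' - y0)) :> R[i].
    by apply/eqP; rewrite eq_complex/=; apply/andP; split; apply/eqP; ring.
  by rewrite /E; ring.
have Ele x y x' y' : a <= x <= b -> c <= y <= d -> a <= x' <= b ->
    c <= y' <= d -> nc (E x y - E x' y') <= 2 * e.
  move=> xab ycd xab' ycd'; have := nc_add (E x y) (- E x' y').
  by rewrite nc_opp; have := ge _ _ xab ycd; have := ge _ _ xab' ycd'; lra.
have aab : a <= a <= b by rewrite lexx.
have bab : a <= b <= b by rewrite lexx andbT.
have ccd : c <= c <= d by rewrite lexx.
have dcd : c <= d <= d by rewrite lexx andbT.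
have h1 : `|segint c d (fun y => complex.Re (g (b +i* y) - g (a +i* y))) -
    complex.Re D * (b - a) * (d - c)| <= 2 * e * (d - c).
  apply: segint_near => //; first exact: flux_vertical gh ab.
  move=> y ycd; rewrite EP Re_add  Re_mul /= subrr mulr0 subr0 addrK.
  by apply: le_trans (Re_le_nc _) _; exact: Ele.
have h2 : `|segint a b (fun x => complex.Im (g (x +i* d) - g (x +i* c))) -
    complex.Re D * (d - c) * (b - a)| <= 2 * e * (b - a).
  apply: segint_near => //; first exact: flux_horizontal gh cd.
  move=> x xab; rewrite EP Im_add Im_mul /= subrr mulr0 addr0 addrK.
  by apply: le_trans (Im_le_nc _) _; exact: Ele.
move: h1 h2; rewrite /flux !ler_norml => /andP[? ?] /andP[? ?].
by apply/andP; split; lra.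
Qed.

Definition quarter g a h c k (F : R) (s : R * R) :=
  [/\ a <= s.1, s.1 + h / 2 <= a + h, c <= s.2, s.2 + k / 2 <= c + k &
   F / 4 <= `|flux g s.1 (s.1 + h / 2) s.2 (s.2 + k / 2)|].

(** The flux is additive, so one quarter carries a quarter of it. *)
Lemma exists_quarter g a h c k F : 0 <= h -> 0 <= k ->
  holo_rect g a (a + h) c (c + k) -> F <= `|flux g a (a + h) c (c + k)| ->
  exists s, quarter g a h c k F s.
Proof.
move=> h0 k0 gh; set m := a + h / 2; set n := c + k / 2.
have am : a <= m by rewrite /m; lra.
have cn : c <= n by rewrite /n; lra.
have mb : m <= a + h by rewrite /m; lra.
have nd : n <= c + k by rewrite /n; lra.
have ab : a <= a + h by lra.
have cd : c <= c + k by lra.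
rewrite (flux_split_x gh am mb cd).
rewrite (@flux_split_y _ _ _ _ n)//; last exact: holo_rectW gh _ _ _ _.
rewrite (@flux_split_y _ m _ _ n)//; last exact: holo_rectW gh _ _ _ _.
have mE : m + h / 2 = a + h by rewrite /m; field.
have nE : n + k / 2 = c + k by rewrite /n; field.
move=> hF.
have [?|h1] := leP (F / 4) `|flux g a m c n|.
  by exists (a, c); split => //=; lra.
have [?|h2] := leP (F / 4) `|flux g a m n (c + k)|.
  by exists (a, n); split => //=; rewrite ?nE//; lra.
have [?|h3] := leP (F / 4) `|flux g m (a + h) c n|.
  by exists (m, c); split => //=; rewrite ?mE//; lra.
have [?|h4] := leP (F / 4) `|flux g m (a + h) n (c + k)|.
  by exists (m, n); split => //=; rewrite ?mE ?nE//; lra.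
have := ler_normD (flux g a m c n + flux g a m n (c + k))
  (flux g m (a + h) c n + flux g m (a + h) n (c + k)).
have := ler_normD (flux g a m c n) (flux g a m n (c + k)).
have := ler_normD (flux g m (a + h) c n) (flux g m (a + h) n (c + k)).
by lra.
Qed.

(** Bisection: nested rectangles of size S / 2^n carrying a flux at least
    F / 4^n shrink to a point, where differentiability bounds the flux by an
    arbitrarily small multiple of (S / 2^n)^2. *)
Lemma goursat_rectangle g a b c d : a <= b -> c <= d ->
  holo_rect g a b c d -> flux g a b c d = 0.
Proof.
move=> ab cd gh; apply/eqP/negPn/negP => F0.
set F := `|flux g a b c d|; have {}F0 : 0 < F by rewrite normr_gt0.
set h := b - a; set k := d - c.
have h0 : 0 <= h by rewrite /h; lra.
have k0 : 0 <= k by rewrite /k; lra.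
pose hn n : R := h / 2 ^+ n; pose kn n : R := k / 2 ^+ n.
have hn0 n : 0 <= hn n by rewrite divr_ge0// exprn_ge0.
have kn0 n : 0 <= kn n by rewrite divr_ge0// exprn_ge0.
have hnS n : hn n.+1 = hn n / 2 by rewrite /hn exprS; field; rewrite expf_neq0.
have knS n : kn n.+1 = kn n / 2 by rewrite /kn exprS; field; rewrite expf_neq0.
have next n (s : R * R) : exists s',
    holo_rect g s.1 (s.1 + hn n) s.2 (s.2 + kn n) ->
    F / 4 ^+ n <= `|flux g s.1 (s.1 + hn n) s.2 (s.2 + kn n)| ->
    quarter g s.1 (hn n) s.2 (kn n) (F / 4 ^+ n) s'.
  have [H|H] := pselect (holo_rect g s.1 (s.1 + hn n) s.2 (s.2 + kn n)); last first.
    by exists s.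
  have [H'|H'] := leP (F / 4 ^+ n) `|flux g s.1 (s.1 + hn n) s.2 (s.2 + kn n)|.
    have [s' s'P] := exists_quarter (hn0 n) (kn0 n) H H'.
    by exists s'.
  by exists s.
have {next}[st stP] := choice (fun ns : nat * (R * R) => next ns.1 ns.2).
pose s := fix s n := if n is n'.+1 then st (n', s n') else (a, c).
have sP n : [/\ holo_rect g (s n).1 ((s n).1 + hn n) (s n).2 ((s n).2 + kn n),
   a <= (s n).1, (s n).1 + hn n <= b, c <= (s n).2 & (s n).2 + kn n <= d] /\
   F / 4 ^+ n <= `|flux g (s n).1 ((s n).1 + hn n) (s n).2 ((s n).2 + kn n)|.
  elim: n => [|n [[H p1 p2 p3 p4] H']].
    rewrite /= /hn /kn expr0 !divr1 /h /k.
    have -> : a + (b - a) = b by ring.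
    have -> : c + (d - c) = d by ring.
    by split.
  have : quarter g (s n).1 (hn n) (s n).2 (kn n) (F / 4 ^+ n) (s n.+1).
    exact: (stP (n, s n) H H').
  rewrite /quarter -hnS -knS.
  move: (s n.+1) => s'; case=> q1 q2 q3 q4 q5; split; last first.
    have -> : F / (4 ^+ n.+1) = F / (4 ^+ n) / 4 by rewrite exprS; field; rewrite expf_neq0.
    exact: q5.
  by split; [apply: holo_rectW H _ _ _ _ => //|..]; lra.
have sS n : quarter g (s n).1 (hn n) (s n).2 (kn n) (F / 4 ^+ n) (s n.+1).
  by have [[H _ _ _ _] H'] := sP n; exact: (stP (n, s n) H H').
have [x xP] : exists x, forall n, (s n).1 <= x <= (s n).1 + hn n.
  apply: nested_segments => n; last by rewrite lerDl.
    by have [] := sS n.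
  by have [_ h1 _ _ _] := sS n; rewrite hnS.
have [y yP] : exists y, forall n, (s n).2 <= y <= (s n).2 + kn n.
  apply: nested_segments => n; last by rewrite lerDl.
    by have [] := sS n.
  by have [_ _ _ h1 _] := sS n; rewrite knS.
have [D gD] : exists D, cdiff g (x +i* y) D.
  apply: gh; [have := xP 0%N|have := yP 0%N]; rewrite /= /hn /kn expr0 divr1 /h /k;
  by move=> /andP[? ?]; apply/andP; split; lra.
pose S := h + k; have S0 : 0 <= S by rewrite /S; lra.
(* the accuracy F / (4 (S^2 + 1)) makes the bound 2 e (S / 2^n)^2 of
   [flux_small] smaller than F / 4^n *)
have S1 : 0 < 4 * (S ^+ 2 + 1) by rewrite mulr_gt0// ltr_wpDl// sqr_ge0.
have [t t0 tP] := gD _ (divr_gt0 F0 S1).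
have [n nP] : exists n, S / 2 ^+ n < t.
  exists (Num.truncn (S / t)).+1; rewrite ltr_pdivrMr ?exprn_gt0//.
  have := truncnS_gt (S / t); rewrite ltr_pdivrMr// mulrC => /lt_le_trans; apply.
  by rewrite ler_pM2l// -natrX ler_nat ltnW// ltn_expl.
have [[H _ _ _ _] H'] := sP n.
set Sn := S / 2 ^+ n in nP.
have SnE : hn n + kn n = Sn by rewrite /hn /kn /Sn /S; ring.
have Sn0 : 0 <= Sn by rewrite -SnE addr_ge0.
have : `|flux g (s n).1 ((s n).1 + hn n) (s n).2 ((s n).2 + kn n)| <=
    2 * (F / (4 * (S ^+ 2 + 1)) * Sn) * Sn.
  have {2}<- : (s n).1 + hn n - (s n).1 + ((s n).2 + kn n - (s n).2) = Sn.
    by rewrite -SnE; ring.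
  apply: (@flux_small g _ _ _ _ x y D _ H); rewrite ?lerDl//.
  move=> u v uP vP; set w := (u - x) +i* (v - y).
  have wS : nc w <= Sn.
    apply: le_trans (nc_le_ReIm _) _; rewrite /w /= -SnE.
    apply: lerD; rewrite ler_norml.
      by move: uP (xP n) => /andP[? ?] /andP[? ?]; apply/andP; split; lra.
    by move: vP (yP n) => /andP[? ?] /andP[? ?]; apply/andP; split; lra.
  have -> : u +i* v = (x +i* y) + w.
    by apply/eqP; rewrite eq_complex/=; apply/andP; split; apply/eqP; ring.
  apply: le_trans (tP w (le_lt_trans wS nP)) _.
  by rewrite ler_wpM2l// divr_ge0 ?ltW.
apply/negP; rewrite -ltNge; apply: lt_le_trans _ H'.
have -> : 2 * (F / (4 * (S ^+ 2 + 1)) * Sn) * Sn =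
    F / 4 ^+ n * (S ^+ 2 / (2 * (S ^+ 2 + 1))).
  have -> : (4 : R) ^+ n = 2 ^+ n * 2 ^+ n by rewrite -exprMn; congr (_ ^+ _); ring.
  rewrite /Sn; field.
  by rewrite expf_neq0//= gt_eqF// ltr_wpDl// sqr_ge0.
rewrite -[ltRHS]mulr1 ltr_pM2l ?divr_gt0 ?exprn_gt0//.
by rewrite ltr_pdivrMr; have := sqr_ge0 S; move: (S ^+ 2) => q; lra.
Qed.

Lemma cexp_period x : cexp (x +i* (2 * pi)) = cexp (x +i* 0) :> R[i].
Proof.
rewrite /cexp/=; congr (_ * _); rewrite /cis -[2 * pi]add0r mulr2n.
by rewrite mulrDl mul1r cosD2pi sinD2pi.
Qed.

(** Apply Goursat's theorem to [G (z0 + exp w)] on [a, ln s] x [0, 2 pi]: the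
    integral of Re G over the circle of radius [s] equals the one over the
    circle of radius [exp a], which is close to 0 as [G z0 = 0]. *)
Lemma no_negative_circle G z0 (s c : R) : 0 < s -> 0 < c ->
  (forall w, nc w <= s -> exists D, cdiff G (z0 + w) D) -> G z0 = 0 ->
  ~ (forall w, nc w = s -> complex.Re (G (z0 + w)) <= - c).
Proof.
move=> s0 c0 Gh Gz0 Gneg.
have [D0 GD0] : exists D, cdiff G (z0 + 0) D by apply: Gh; rewrite nc0 ltW.
have c2 : 0 < c / 2 by rewrite divr_gt0.
have [t t0 tP] := cdiff_cont GD0 c2.
pose b := ln s; pose a := ln (Num.min s (t / 2)).
have m0 : 0 < Num.min s (t / 2) by rewrite lt_min s0 divr_gt0.
have ab : a <= b by rewrite ler_ln ?posrE// ge_min lexx.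
pose g w := G (z0 + cexp w).
have gh : holo_rect g a b 0 (2 * pi).
  move=> x y /andP[_ xb] _.
  have [D GD] : exists D, cdiff G (z0 + cexp (x +i* y)) D.
    by apply: Gh; rewrite nc_cexp/= -[leRHS]lnK ?posrE// ler_expR.
  exists (D * (1 * cexp (x +i* y))).
  have h1 := cdiff_comp (cdiff_cexp (x +i* y)) (cdiff_affine z0 1 _).
  have h2 : cdiff (fun w => z0 + cexp w) (x +i* y) (1 * cexp (x +i* y)).
    by apply: cdiff_eq h1 => w /=; rewrite mul1r.
  exact: cdiff_comp h2 GD.
have p0 : 0 < 2 * pi :> R by rewrite mulr_gt0// pi_gt0.
have := goursat_rectangle ab (ltW p0) gh; rewrite /flux.
have -> : segint a b (fun x => complex.Im (g (x +i* (2 * pi)) - g (x +i* 0))) = 0.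
  rewrite (eq_segint (g := fun=> 0)) ?segint_cst ?mul0r// => x _.
  by rewrite /g cexp_period subrr.
rewrite subr0; apply/eqP; rewrite lt_eqF//.
apply: (@le_lt_trans _ _ (segint 0 (2 * pi) (fun=> - (c / 2)))); last first.
  by rewrite segint_cst ?ltW// subr0 mulNr oppr_lt0 mulr_gt0.
apply: segint_le; [exact: flux_vertical gh ab|exact: segcont_cst|move=> y _].
rewrite Re_add Re_opp /g.
have h1 : complex.Re (G (z0 + cexp (b +i* y))) <= - c.
  by apply: Gneg; rewrite nc_cexp/= lnK ?posrE.
have /tP : nc (cexp (a +i* y)) < t.
  rewrite nc_cexp/= lnK ?posrE// gt_min.
  by rewrite orbC; apply/orP; left; lra.
rewrite !addr0 Gz0 subr0 => h2.
have := Re_le_nc (G (z0 + cexp (a +i* y))); rewrite ler_norml => /andP[h3 _].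
lra.
Qed.

End Goursat.

(** * Convexity of powers *)

Section PowerTangent.
Context {R : realType}.
Implicit Types (p q x y t m : R).

(** This is Young's inequality applied to [t] and [m `^ (p - 1)]. *)
Lemma powR_tangent p t m : 1 < p -> 0 <= t -> 0 <= m ->
  m `^ p + p * m `^ (p - 1) * (t - m) <= t `^ p.
Proof.
move=> p1 t0 m0; have p0 : 0 < p by lra.
have pp1 : 0 < p - 1 by lra.
have q0 : 0 < p / (p - 1) by rewrite divr_gt0.
have pq : p^-1 + (p / (p - 1))^-1 = 1 by field; rewrite !gt_eqF.
have := conjugate_powR t0 (powR_ge0 m (p - 1)) p0 q0 pq.
rewrite -powRrM mulrCA divff ?gt_eqF// mulr1 => h.
have hm := mulr_powRB1 m0 p0.
rewrite -(ler_pM2l p0) in h.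
have hE : p * (t `^ p / p + m `^ p / (p / (p - 1))) =
    t `^ p + (p - 1) * m `^ p by field; rewrite !gt_eqF.
rewrite hE in h.
have -> : p * m `^ (p - 1) * (t - m) =
  p * (t * m `^ (p - 1)) - p * (m * m `^ (p - 1)) by ring.
by rewrite hm; lra.
Qed.

Lemma powR_bernoulli p x : 1 < p -> 0 <= 1 + x -> 1 + p * x <= (1 + x) `^ p.
Proof.
move=> p1 x0; have := powR_tangent p1 x0 ler01.
by rewrite powR1 mulr1 addrAC subrr add0r.
Qed.

(** The convex inequality with exponent 1/q, read at [(1 + x) `^ q]. *)
Lemma powR_bernoulli_concave q x : 0 < q -> q <= 1 -> 0 <= 1 + x ->
  (1 + x) `^ q <= 1 + q * x.
Proof.
move=> q0; rewrite le_eqVlt => /predU1P[->|q1] x0.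
  by rewrite powRr1// mul1r.
have p1 : 1 < q^-1 by rewrite invf_gt1.
have := powR_tangent p1 (powR_ge0 (1 + x) q) ler01.
rewrite powR1 mulr1 -powRrM divff ?gt_eqF// powRr1// => h.
have := ler_wpM2l (ltW q0) h; rewrite mulrDr mulrA divff ?gt_eqF//.
by lra.
Qed.

Lemma powR_continuous_ge0 p x : 0 < p -> 0 <= x ->
  forall e : R, 0 < e -> exists2 t : R, 0 < t &
    forall y, 0 <= y -> `|y - x| < t -> `|y `^ p - x `^ p| < e.
Proof.
move=> p0; rewrite le_eqVlt => /predU1P[<-|x0] e e0.
  exists (e `^ p^-1); first by rewrite powR_gt0.
  move=> y y0; rewrite subr0 ger0_norm// powR0 ?gt_eqF// subr0.
  rewrite ger0_norm ?powR_ge0// => ye.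
  have -> : e = (e `^ p^-1) `^ p.
    by rewrite -powRrM mulVf ?gt_eqF// powRr1// ltW.
  by rewrite gt0_ltr_powR// nnegrE ?powR_ge0.
have := is_derive1_powR p x0 => -[/derivable1_diffP/differentiable_continuous pc _].
have [t t0 tP] := continuous_epsilon pc e0.
by exists t => // y _ /tP; rewrite (addrC x) subrK.
Qed.

(** The tangent of t^p at |w0| composed with the linear form
    w |-> Re (conj w0 w) / |w0|, which is at most |w| with equality at [w0]. *)
Lemma support_functional p (w0 : R[i]) : 1 < p ->
  exists c : R[i], forall w,
    nc w0 `^ p + complex.Re (c * (w - w0)) <= nc w `^ p.
Proof.
move=> p1; have p0 : 0 < p by lra.
have [->|w00] := eqVneq w0 0.
  exists 0 => w; rewrite mul0r nc0 powR0 ?gt_eqF// add0r.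
  exact: powR_ge0.
have m0 : 0 < nc w0 by rewrite nc_gt0.
exists ((p * nc w0 `^ (p - 1) / nc w0)%:C * (w0^*)%C) => w.
apply: le_trans _ (powR_tangent p1 (nc_ge0 w) (ltW m0)).
have key : complex.Re ((w0^*)%C * (w - w0)) <= (nc w - nc w0) * nc w0.
  rewrite mulrBr Re_add Re_opp.
  have -> : complex.Re ((w0^*)%C * w0) = nc w0 ^+ 2.
    by rewrite nc_sqr; case: (w0) => a b /=; ring.
  have := Re_le_nc ((w0^*)%C * w); rewrite ler_norml ncM => /andP[_].
  have -> : nc (w0^*)%C = nc w0 by rewrite !ncE; case: (w0) => a b /=; rewrite sqrrN.
  by lra.
rewrite lerD2l -[_%:C * _ * _]mulrA Re_mul /= mul0r subr0 -[_ / _ * _]mulrA.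
apply: ler_wpM2l; first by rewrite mulr_ge0 ?powR_ge0// ltW.
by rewrite mulrC ler_pdivrMr.
Qed.

End PowerTangent.

(** * A maximum principle for averages of |h|^p over rotations *)

Section MaximumPrinciple.
Context {R : realType}.
Implicit Types (p r s t : R) (h : R[i] -> R[i]) (z w : R[i]) (F : R[i] -> R).

Definition rcont F z := forall e : R, 0 < e -> exists2 t : R, 0 < t &
  forall d, nc d < t -> `|F (z + d) - F z| < e.

Lemma rcont_nc_powR p h z : 0 < p -> ccont h z ->
  rcont (fun w => nc (h w) `^ p) z.
Proof.
move=> p0 hc e e0.
have [t t0 tP] := powR_continuous_ge0 p0 (nc_ge0 (h z)) e0.
have [s s0 sP] := hc _ t0; exists s => // d /sP ds.
apply: tP; first exact: nc_ge0.
exact: le_lt_trans (nc_dist _ _) ds.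
Qed.

Lemma rcont_rot F z u : nc u = 1 -> rcont F (z * u) -> rcont (fun w => F (w * u)) z.
Proof.
move=> u1 Fc e /Fc[t t0 tP]; exists t => // d dt.
by rewrite mulrDl; apply: tP; rewrite ncM u1 mulr1.
Qed.

Lemma rcontD F1 F2 z : rcont F1 z -> rcont F2 z ->
  rcont (fun w => F1 w + F2 w) z.
Proof.
move=> c1 c2 e e0; have e2 : 0 < e / 2 by rewrite divr_gt0.
have [t t0 tP] := c1 _ e2; have [s s0 sP] := c2 _ e2.
exists (Num.min t s); first by rewrite lt_min t0.
move=> d; rewrite lt_min => /andP[/tP dt /sP ds].
rewrite opprD addrACA; apply: le_lt_trans (ler_normD _ _) _; lra.
Qed.

Lemma rcont_sum (I : Type) (l : seq I) (F : I -> R[i] -> R) z :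
  (forall i, rcont (F i) z) -> rcont (fun w => \sum_(i <- l) F i w) z.
Proof.
move=> Fc; elim: l => [|i l IH].
  by move=> e e0; exists 1 => // d _; rewrite !big_nil subrr normr0.
move=> e e0; have [t t0 tP] := rcontD (Fc i) IH e0; exists t => // d /tP.
by rewrite !big_cons.
Qed.

Lemma rcont_comp (phi : R -> R) F z : {for F z, continuous phi} -> rcont F z ->
  rcont (fun w => phi (F w)) z.
Proof.
move=> pc Fc e e0; have [t t0 tP] := continuous_epsilon pc e0.
have [s s0 sP] := Fc _ t0; exists s => // d /sP /tP.
by rewrite (addrC (F z)) subrK.
Qed.

Lemma rcont_nc z : rcont (fun w => nc w) z.
Proof.
move=> e e0; exists e => // d; apply: le_lt_trans.
by apply: le_trans (nc_dist _ _) _; rewrite addrAC subrr add0r.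
Qed.

Lemma polar z : exists2 t : R, - pi <= t <= pi & z = (nc z)%:C * cis t.
Proof.
have [->|z0] := eqVneq z 0.
  by exists 0; rewrite ?oppr_le0 ?pi_ge0// nc0 mul0r.
have m0 : 0 < nc z by rewrite nc_gt0.
have [a [b zE]] : exists a b, z = a +i* b by case: (z) => a b; exists a, b.
have mE : nc z ^+ 2 = a ^+ 2 + b ^+ 2 by rewrite nc_sqr zE.
have am := Re_le_nc z; rewrite {1}zE /= in am.
set m := nc z in m0 mE am *.
pose x := a / m; pose y := b / m.
have xy : x ^+ 2 + y ^+ 2 = 1.
  by rewrite /x /y !expr_div_n -mulrDl -mE divff// expf_neq0// gt_eqF.
have x1 : -1 <= x <= 1.
  by rewrite -ler_norml /x normrM normfV (gtr0_norm m0) ler_pdivrMr// mul1r.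
have sq : Num.sqrt (1 - x ^+ 2) = `|y|.
  by rewrite -xy addrAC subrr add0r sqrtr_sqr.
have ca := acosK x1; have sa := sin_acos x1.
have aP : 0 <= acos x <= pi by rewrite acos_ge0//= acos_lepi.
have zxy : z = m%:C * (x +i* y).
  have mx : m * x = a by rewrite /x mulrC divfK ?gt_eqF.
  have my : m * y = b by rewrite /y mulrC divfK ?gt_eqF.
  by rewrite zE; apply/eqP; rewrite eq_complex/= !mul0r subr0 addr0 mx my !eqxx.
have [y0|y0] := leP 0 y.
  exists (acos x); first by move: aP => /andP[? ?]; apply/andP; split; lra.
  by rewrite zxy /cis ca sa sq ger0_norm.
exists (- acos x); first by move: aP => /andP[? ?]; apply/andP; split; lra.
by rewrite zxy /cis cosN sinN ca sa sq ltr0_norm// opprK.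
Qed.

(** Polar coordinates exhibit the closed disk as the image of a compact
    rectangle. *)
Lemma rcont_max F (r : R) : 0 <= r -> (forall z, nc z <= r -> rcont F z) ->
  exists2 z, nc z <= r & forall w, nc w <= r -> F w <= F z.
Proof.
move=> r0 Fc.
pose K : set (R * R) := `[0, r]%classic `*` `[- pi, pi]%classic.
pose P (x : R * R) : R[i] := x.1%:C * cis x.2.
have ncP x : nc (P x) = `|x.1| by rewrite /P ncM nc_cis mulr1 nc_real.
have PK x : K x -> nc (P x) <= r.
  by rewrite ncP => -[/=]; rewrite in_itv/= => /andP[x0 xr] _; rewrite ger0_norm.
have [|||c cK cP] := @compact_EVT_max _ _ (F \o P) K.
- exists (0, 0); split => /=; rewrite in_itv/= ?lexx//.
  by rewrite oppr_le0 pi_ge0.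
- by apply: compact_setX; exact: segment_compact.
- apply: continuous_in_subspaceT => -[a b]; rewrite inE => abK.
  apply/cvgrPdist_lt => e e0.
  have [t t0 tP] := Fc _ (PK _ abK) _ e0.
  have ca : 0 < t / (4 * (1 + `|a|)) :> R.
    by rewrite divr_gt0// mulr_gt0// ltr_wpDr.
  have [u u0 uP] := continuous_epsilon (continuous_cos (x := b)) ca.
  have [v v0 vP] := continuous_epsilon (continuous_sin (x := b)) ca.
  exists (ball a (t / 4), ball b (Num.min u v)).
    by split => /=; apply: nbhsx_ballx; rewrite ?lt_min ?u0// divr_gt0.
  move=> [a' b'] [] /=; rewrite /ball/= lt_min => aa /andP[bu bv].
  rewrite distrC in aa; rewrite distrC in bu; rewrite distrC in bv.
  have := uP _ bu; have := vP _ bv; rewrite (addrC b) subrK => hs hc.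
  rewrite distrC; have -> : P (a', b') = P (a, b) + (P (a', b') - P (a, b)) by ring.
  apply: tP; apply: le_lt_trans (nc_le_ReIm _) _.
  rewrite /P /= !mul0r !subr0 !addr0.
  set C := cos b in hc *; set C' := cos b' in hc *.
  set S := sin b in hs *; set S' := sin b' in hs *.
  have C1 : `|C'| <= 1 by rewrite ler_norml cos_geN1 cos_le1.
  have S1 : `|S'| <= 1 by rewrite ler_norml sin_geN1 sin_le1.
  have -> : a' * C' - a * C = (a' - a) * C' + a * (C' - C) by ring.
  have -> : a' * S' - a * S = (a' - a) * S' + a * (S' - S) by ring.
  have A0 := normr_ge0 a.
  have aca : `|a| * (t / (4 * (1 + `|a|))) <= t / 4.
    have -> : t / 4 = (1 + `|a|) * (t / (4 * (1 + `|a|))).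
      by field; rewrite gt_eqF// ltr_wpDr.
    by rewrite ler_wpM2r ?ltW//; lra.
  have k1 := ler_normD ((a' - a) * C') (a * (C' - C)).
  have k2 := ler_normD ((a' - a) * S') (a * (S' - S)).
  have k3 : `|(a' - a) * C'| <= `|a' - a| by rewrite normrM ler_piMr.
  have k4 : `|(a' - a) * S'| <= `|a' - a| by rewrite normrM ler_piMr.
  have k5 : `|a * (C' - C)| <= t / 4.
    by rewrite normrM (le_trans _ aca)// ler_wpM2l// ltW.
  have k6 : `|a * (S' - S)| <= t / 4.
    by rewrite normrM (le_trans _ aca)// ler_wpM2l// ltW.
  lra.
exists (P c); first by apply: PK; rewrite inE in cK.
move=> w wr; have [t tP ->] := polar w; apply: (cP (nc w, t)).
rewrite inE; split => /=; rewrite in_itv/= ?nc_ge0//.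
Qed.

Definition orbit_sum p N (u : nat -> R[i]) h z :=
  \sum_(k < N) nc (h (z * u k)) `^ p.

Lemma nc_rotate_lt1 u z r : nc u = 1 -> nc z <= r -> r < 1 -> nc (z * u) < 1.
Proof. by move=> u1 zr r1; rewrite ncM u1 mulr1 (le_lt_trans zr). Qed.

Lemma nc_sqr_expand z w : nc w ^+ 2 =
  nc z ^+ 2 + 2 * complex.Re ((z^*)%C * (w - z)) + nc (w - z) ^+ 2.
Proof. by rewrite !nc_sqr; case: z => a b; case: w => c d /=; ring. Qed.

(** At an interior maximum [z] of [orbit_sum + e |.|^2], replacing each |h|^p by
    its supporting functional and |.|^2 by its linear part at [z] leaves a
    holomorphic function that vanishes at [z] and has real part at most
    - e |w|^2 at every point [z + w] of the disk.  The perturbation is what makes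
    this strict, and it is the reason for the error term e r^2. *)
Lemma orbit_sum_max p N u h r e : 1 < p -> 0 <= r < 1 -> 0 < e ->
  (forall k, nc (u k) = 1) ->
  (forall z, nc z < 1 -> exists D, cdiff h z D) ->
  exists t, - pi <= t <= pi /\
    forall w, nc w <= r -> orbit_sum p N u h w <=
      orbit_sum p N u h (r%:C * cis t) + e * r ^+ 2.
Proof.
move=> p1 /andP[r0 r1] e0 u1 hh; have p0 : 0 < p by lra.
pose F z := orbit_sum p N u h z + e * nc z ^+ 2.
have [z zr|z zr zmax] := @rcont_max F r r0.
  apply: rcontD.
    apply: rcont_sum => k.
    have [D hD] := hh _ (nc_rotate_lt1 (u1 k) zr r1).
    apply: (@rcont_rot (fun w => nc (h w) `^ p)) => //.
    by apply: rcont_nc_powR => //; exact: cdiff_cont hD.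
  apply: (@rcont_comp (fun x => e * x ^+ 2)); last exact: rcont_nc.
  by apply: cvgM; [exact: cvg_cst|apply: exprn_continuous].
have zE : nc z = r.
  apply/eqP; rewrite eq_le zr /= leNgt; apply/negP => zr'.
  pose c k := projT1 (cid (support_functional (h (z * u k)) p1)).
  have cP k : forall w, nc (h (z * u k)) `^ p +
      complex.Re (c k * (w - h (z * u k))) <= nc w `^ p.
    exact: projT2 (cid (support_functional (h (z * u k)) p1)).
  pose G w := \sum_(k < N) c k * (- h (z * u k) + h (w * u k)) +
     (- ((2 * e)%:C * (z^*)%C * z) + (2 * e)%:C * (z^*)%C * w).
  have s0 : 0 < r - nc z by lra.
  have c0 : 0 < e * (r - nc z) ^+ 2 by rewrite mulr_gt0// exprn_gt0.
  apply: (@no_negative_circle R G z _ _ s0 c0) => [w ws||w ws].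
  - have zw : nc (z + w) <= r by have := nc_add z w; lra.
    have [D1 GD1] : exists D, cdiff
       (fun w => \sum_(k < N) c k * (- h (z * u k) + h (w * u k))) (z + w) D.
      apply: cdiff_sum => k.
      have hu : cdiff (fun w => w * u k) (z + w) (u k).
        by apply: cdiff_eq (cdiff_affine 0 (u k) (z + w)) => v; rewrite add0r mulrC.
      have [D hD] := hh _ (nc_rotate_lt1 (u1 k) zw r1).
      have h1 := cdiff_comp hu hD.
      by eexists; apply: cdiffZ; apply: cdiffD h1; exact: cdiff_cst.
    by eexists; apply: cdiffD GD1 _; exact: cdiff_affine.
  - rewrite /G addNr addr0 big1// => k _.
    by rewrite addNr mulr0.
  - have zw : nc (z + w) <= r by have := nc_add z w; lra.
    have := zmax _ zw; rewrite /F (nc_sqr_expand z (z + w)).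
    have -> : z + w - z = w by ring.
    rewrite ws.
    have : orbit_sum p N u h z + complex.Re (\sum_(k < N) c k *
        (- h (z * u k) + h ((z + w) * u k))) <= orbit_sum p N u h (z + w).
      rewrite /orbit_sum (big_morph _ (@Re_add R) (erefl _)) -big_split /=.
      by apply: ler_sum => k _; rewrite [- _ + _]addrC; exact: cP.
    rewrite /G Re_add.
    have -> : - ((2 * e)%:C * z^*%C * z) + (2 * e)%:C * z^*%C * (z + w) =
      (2 * e)%:C * (z^*%C * w) by ring.
    rewrite [complex.Re (_%:C * _)]Re_mul /= mul0r subr0.
    set A := complex.Re (\sum_(_ < _) _).
    set B := complex.Re (z^*%C * w); lra.
have [t tP tz] := polar z; exists t; split => // w wr.
rewrite -zE -tz; have := zmax _ wr; rewrite /F.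
have := mulr_ge0 (ltW e0) (sqr_ge0 (nc w)); lra.
Qed.

End MaximumPrinciple.

(** * Riemann sums of periodic functions *)

Section RiemannSums.
Context {R : realType}.
Implicit Types (a b t d : R) (f k : R -> R).

Lemma segcont_uniform a b f : segcont a b f -> forall e : R, 0 < e ->
  exists2 t, 0 < t & forall x y, a <= x <= b -> a <= y <= b ->
    `|y - x| < t -> `|f y - f x| < e.
Proof.
move=> fc e e0; have e2 : 0 < e / 2 by rewrite divr_gt0.
have /compact_near_coveringP cov := @segment_compact R a b.
pose P (t x : R) := forall y, `|y - x| < t -> `|f y - f x| < e.
have : \forall t \near (0 : R)^'+, `[a, b] `<=` P t.
  apply: cov => x; rewrite /= in_itv/= => xab.
  have [s s0 sP] := continuous_epsilon (fc _ xab) e2.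
  exists (ball x (s / 2), [set t | 0 < t < s / 2]).
    split => /=; first by apply: nbhsx_ballx; rewrite divr_gt0.
    by near=> t; apply/andP; split; near: t;
       [exact: nbhs_right_gt|apply: nbhs_right_lt; rewrite divr_gt0].
  move=> [x' t] [/=]; rewrite /ball/= => xx' /andP[t0 ts] y yx'.
  have h1 : `|f x' - f x| < e / 2.
    have := sP (x' - x); rewrite (addrC x) subrK; apply.
    by rewrite distrC; lra.
  have h2 : `|f y - f x| < e / 2.
    have := sP (y - x); rewrite (addrC x) subrK; apply.
    have -> : y - x = (y - x') + (x' - x) by ring.
    by rewrite (le_lt_trans (ler_normD _ _))// (distrC x'); lra.
  have -> : f y - f x' = (f y - f x) + (f x - f x') by ring.
  by rewrite (le_lt_trans (ler_normD _ _))// (distrC (f x)); lra.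
move=> covP.
near (0 : R)^'+ => t; exists t => //.
move=> x y xab _; have : `[a, b] `<=` P t by near: t.
by move=> /(_ x); rewrite /= in_itv/= => /(_ xab); exact.
Unshelve. all: by end_near. Qed.

Lemma segint_pieces n d k : 0 <= d -> segcont 0 (n%:R * d) k ->
  segint 0 (n%:R * d) k = \sum_(j < n) segint (j%:R * d) (j.+1%:R * d) k.
Proof.
move=> d0; elim: n => [|n IH] kc.
  rewrite big_ord0 mul0r /segint set_itv1; exact: Rintegral_set1.
have nd : n%:R * d <= n.+1%:R * d by rewrite ler_wpM2r// ler_nat.
have n0 : 0 <= n%:R * d by rewrite mulr_ge0.
rewrite big_ord_recr /= -IH; first exact: segint_split.
by move=> x /andP[x0 xn]; apply: kc; rewrite x0 (le_trans xn).
Qed.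

(** Every node moves onto the next one, and the last one onto the first one plus
    a period. *)
Lemma riemann_shift N t k : (0 < N)%N -> (forall x, k (x + 2 * pi) = k x) ->
  let d := 2 * pi / N%:R in
  \sum_(j < N) k (t + d + j%:R * d) = \sum_(j < N) k (t + j%:R * d).
Proof.
case: N => // N _ kper d; rewrite [LHS]big_ord_recr [RHS]big_ord_recl /= addrC.
congr (_ + _); last first.
  by apply: eq_bigr => j _; congr k; rewrite /bump/= natrD; ring.
rewrite -[in RHS]kper; congr k; rewrite /d -natr1; field.
by rewrite nat1r pnatr_eq0.
Qed.

(** The convergence is uniform in the position [t] of the first node: below,
    the nodes start at the unknown argument of a maximum point. *)
Lemma riemann_sum_cvg k : (forall x, k (x + 2 * pi) = k x) ->
  (forall x, {for x, continuous k}) -> forall e : R, 0 < e ->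
  exists N0, forall N t, (N0 <= N)%N -> (0 < N)%N -> - (2 * pi) <= t ->
  `|segint 0 (2 * pi) k - 2 * pi / N%:R * \sum_(j < N) k (t + j%:R * (2 * pi / N%:R))|
    <= e.
Proof.
move=> kper kc e e0; have p0 : 0 < 2 * pi :> R by rewrite mulr_gt0// pi_gt0.
have ep : 0 < e / (2 * pi) by rewrite divr_gt0.
have [s s0 sP] := @segcont_uniform 0 (2 * pi) k (fun x _ => kc x) _ ep.
exists (Num.truncn (2 * pi / s)).+1 => N t NN N0 t0.
set d := 2 * pi / N%:R.
have N0' : 0 < N%:R :> R by rewrite ltr0n.
have d0 : 0 < d by rewrite divr_gt0.
have dN : N%:R * d = 2 * pi by rewrite /d mulrC divfK// gt_eqF.
have ds : d < s.
  rewrite /d ltr_pdivrMr// [s * _]mulrC -ltr_pdivrMr//.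
  by apply: lt_le_trans (truncnS_gt _) _; rewrite ler_nat.
(* by periodicity the nodes may be assumed to start in the first cell, so that
   the j-th node lies in the j-th cell of [0, 2 pi] *)
suff H u : 0 <= u <= d -> `|segint 0 (2 * pi) k - d * \sum_(j < N) k (u + j%:R * d)| <= e.
  have shiftn n u : \sum_(j < N) k (u + n%:R * d + j%:R * d) =
      \sum_(j < N) k (u + j%:R * d).
    elim: n => [|n IH]; first by rewrite mul0r addr0.
    rewrite -IH -(riemann_shift (u + n%:R * d) N0 kper) -/d.
    by apply: eq_bigr => j _; congr k; rewrite -natr1; ring.
  set t' := t + 2 * pi.
  pose m := Num.truncn (t' / d).
  have t'0 : 0 <= t' by rewrite /t'; lra.
  have mle : m%:R * d <= t'.
    by rewrite -ler_pdivlMr// truncn_le// divr_ge0// ltW.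
  have mlt : t' < (m%:R + 1) * d.
    by rewrite -ltr_pdivrMr// natr1 truncnS_gt.
  have -> : \sum_(j < N) k (t + j%:R * d) =
      \sum_(j < N) k ((t' - m%:R * d) + j%:R * d).
    rewrite -[RHS](shiftn m); apply: eq_bigr => j _.
    rewrite subrK -[LHS]kper; congr k; rewrite /t'; ring.
  by apply: H; apply/andP; split; lra.
move=> /andP[u0 ud]; rewrite -dN segint_pieces; [|exact: ltW|by move=> x _; exact: kc].
rewrite mulr_sumr -sumrB.
apply: le_trans (ler_norm_sum _ _ _) _.
apply: (@le_trans _ _ (\sum_(j < N) e / (2 * pi) * d)); last first.
  by rewrite sumr_const card_ord -[_ *+ N]mulr_natr -mulrA [d * _]mulrC dN divfK// gt_eqF.
apply: ler_sum => j _.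
have jd : j%:R * d <= j.+1%:R * d by rewrite ler_wpM2r ?ler_nat// ltW.
have j0 : 0 <= j%:R * d by rewrite mulr_ge0// ltW.
have jN : j.+1%:R * d <= 2 * pi.
  by rewrite -dN ler_wpM2r ?ler_nat// ltW.
have jE : j.+1%:R * d = j%:R * d + d by rewrite -natr1; ring.
have := @segint_near R _ _ k (k (u + j%:R * d)) (e / (2 * pi)) jd (fun x _ => kc x).
have -> : j.+1%:R * d - j%:R * d = d by rewrite jE; ring.
rewrite [k _ * d]mulrC; apply => x /andP[jx xj].
apply/ltW/sP; [apply/andP; split; lra..|].
by apply: le_lt_trans ds; rewrite ler_norml; apply/andP; split; lra.
Qed.

End RiemannSums.

(** * Monotonicity of the circular means *)

Section CircularMeans.
Context {R : realType}.
Implicit Types (p r t : R) (h : R[i] -> R[i]).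

Definition circle_power p h r t := nc (h (r%:C * cis t)) `^ p.

Definition circ_mean p h r := (2 * pi)^-1 * segint 0 (2 * pi) (circle_power p h r).

Definition holo_disk h := forall z, nc z < 1 -> exists D, cdiff h z D.

Lemma cis2pi t : cis (t + 2 * pi) = cis t :> R[i].
Proof. by rewrite /cis mulr2n mulrDl mul1r cosD2pi sinD2pi. Qed.

Lemma circle_power_continuous p h r : 0 < p -> holo_disk h -> 0 <= r < 1 ->
  forall t, {for t, continuous (circle_power p h r)}.
Proof.
move=> p0 hh /andP[r0 r1] t; apply: epsilon_continuous => e e0.
have [D hD] : exists D, cdiff h (r%:C * cis t) D.
  by apply: hh; rewrite ncM nc_cis mulr1 nc_real ger0_norm.
have [s s0 sP] := rcont_nc_powR p0 (cdiff_cont hD) e0.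
have s2 : 0 < s / 2 by rewrite divr_gt0.
have [u u0 uP] := continuous_epsilon (continuous_cos (x := t)) s2.
have [v v0 vP] := continuous_epsilon (continuous_sin (x := t)) s2.
exists (Num.min u v); first by rewrite lt_min u0.
move=> d; rewrite lt_min => /andP[/uP ud /vP vd]; rewrite /circle_power.
have -> : r%:C * cis (t + d) = r%:C * cis t + (r%:C * cis (t + d) - r%:C * cis t) by ring.
apply: sP; rewrite -mulrBr ncM nc_real ger0_norm//.
have := nc_le_ReIm (cis (t + d) - cis t) => /=.
by have := nc_ge0 (cis (t + d) - cis t); nra.
Qed.

(** Both means are within e/4 of Riemann sums over N rotated nodes; the sum at
    radius [r] is an orbit sum, hence is dominated by one at radius [r']. *)
Lemma circ_mean_le p h r r' : 1 < p -> holo_disk h -> 0 <= r -> r <= r' ->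
  r' < 1 -> circ_mean p h r <= circ_mean p h r'.
Proof.
move=> p1 hh r0 rr r'1; have p0 : 0 < p by lra.
have pp0 : 0 < 2 * pi :> R by rewrite mulr_gt0// pi_gt0.
rewrite /circ_mean; apply: ler_wpM2l; first by rewrite invr_ge0 ltW.
apply/ler_addgt0Pr => e e0.
have e4 : 0 < e / 4 by rewrite divr_gt0.
have per s t : circle_power p h s (t + 2 * pi) = circle_power p h s t.
  by rewrite /circle_power cis2pi.
have r1 : 0 <= r < 1 by rewrite r0 (le_lt_trans rr).
have r'1' : 0 <= r' < 1 by rewrite (le_trans r0).
have [N1 N1P] := riemann_sum_cvg (per r) (circle_power_continuous p0 hh r1) e4.
have [N2 N2P] := riemann_sum_cvg (per r') (circle_power_continuous p0 hh r'1') e4.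
pose N := (maxn N1 N2).+1; pose d : R := 2 * pi / N%:R.
pose u j : R[i] := cis (j%:R * d).
have N0 : 0 < N%:R :> R by rewrite ltr0n.
have d0 : 0 < d by rewrite divr_gt0.
pose e' := e / (2 * d).
have e'0 : 0 < e' by rewrite divr_gt0// mulr_gt0.
have [t [tP tmax]] := orbit_sum_max N p1 r'1' e'0 (fun j => nc_cis (j%:R * d)) hh.
have sumE s x : orbit_sum p N u h (s%:C * cis x) =
    \sum_(j < N) circle_power p h s (x + j%:R * d).
  by apply: eq_bigr => j _; rewrite /circle_power cisD mulrA.
have NN1 : (N1 <= N)%N by rewrite leqW// leq_maxl.
have NN2 : (N2 <= N)%N by rewrite leqW// leq_maxr.
have t0 : - (2 * pi) <= t.
  by have := pi_gt0 R; move: tP => /andP[? _]; lra.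
have h1 := N1P N 0 NN1 isT; rewrite oppr_le0 ltW// -/d in h1.
have h2 := N2P N t NN2 isT t0; rewrite -/d in h2.
have h3 : d * \sum_(j < N) circle_power p h r (0 + j%:R * d) <=
    d * \sum_(j < N) circle_power p h r' (t + j%:R * d) + e / 2.
  rewrite -!sumE; have := tmax (r%:C * cis 0).
  rewrite ncM nc_cis nc_real mulr1 ger0_norm// => /(_ rr).
  rewrite -(ler_pM2l d0) mulrDr => h3; apply: le_trans h3 _; rewrite lerD2l.
  have -> : d * (e' * r' ^+ 2) = e / 2 * r' ^+ 2.
    by rewrite /e'; field; rewrite gt_eqF.
  rewrite ler_piMr ?divr_ge0 ?(ltW e0)// expr_le1 ?(ltW r'1)//.
  exact: le_trans rr.
have arith (I1 I2 x y : R) : `|I1 - x| <= e / 4 -> `|I2 - y| <= e / 4 ->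
    x <= y + e / 2 -> I1 <= I2 + e.
  by rewrite !ler_distl => /andP[? ?] /andP[? ?] ?; lra.
exact: arith (h1 isT) h2 h3.
Qed.

End CircularMeans.

(** * Two-point inequalities *)

Section TwoPoint.
Context {R : realType}.
Implicit Types (p q s t x y a b : R) (z w u v : R[i]).

Lemma powR_midpoint q x y : 1 <= q -> 0 <= x -> 0 <= y ->
  2 * ((x + y) / 2) `^ q <= x `^ q + y `^ q.
Proof.
rewrite le_eqVlt => /predU1P[<-|q1] x0 y0.
  by rewrite !powRr1 ?divr_ge0 ?addr_ge0//; lra.
have m0 : 0 <= (x + y) / 2 by rewrite divr_ge0// addr_ge0.
have := powR_tangent q1 x0 m0; have := powR_tangent q1 y0 m0.
set m := (x + y) / 2; have -> : y = m + m - x by rewrite /m; field.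
set T := q * m `^ (q - 1) => h1 h2.
lra.
Qed.

Lemma powR_superadditive q x y : 1 <= q -> 0 <= x -> 0 <= y ->
  x `^ q + y `^ q <= (x + y) `^ q.
Proof.
move=> q1 x0 y0; have q0 : 0 < q by lra.
rewrite -(mulr_powRB1 x0 q0) -(mulr_powRB1 y0 q0) -(mulr_powRB1 (addr_ge0 x0 y0) q0).
rewrite mulrDl; apply: lerD; apply: ler_wpM2l => //.
- by apply: ge0_ler_powR; rewrite ?nnegrE; lra.
- by apply: ge0_ler_powR; rewrite ?nnegrE; lra.
Qed.

(** In terms of x^q and y^q this is convexity of the power 1/q. *)
Lemma powR_concave q l x y : 0 < q -> q <= 1 -> 0 <= l <= 1 -> 0 <= x -> 0 <= y ->
  l * x `^ q + (1 - l) * y `^ q <= (l * x + (1 - l) * y) `^ q.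
Proof.
move=> q0; rewrite le_eqVlt => /predU1P[->|q1] /andP[l0 l1] x0 y0.
  by rewrite !powRr1// addr_ge0// mulr_ge0//; lra.
have p1 : 1 < q^-1 by rewrite invf_gt1.
set m := l * _ + _.
have m0 : 0 <= m.
  by rewrite addr_ge0// mulr_ge0 ?powR_ge0//; lra.
have root (t : R) : 0 <= t -> (t `^ q) `^ q^-1 = t.
  by move=> t0; rewrite -powRrM divff ?gt_eqF// powRr1.
have := powR_tangent p1 (powR_ge0 x q) m0; have := powR_tangent p1 (powR_ge0 y q) m0.
rewrite !root// => hy hx.
have hm : m `^ q^-1 <= l * x + (1 - l) * y.
  set T := q^-1 * _ in hx hy.
  have -> : m `^ q^-1 = l * (m `^ q^-1 + T * (x `^ q - m)) +
      (1 - l) * (m `^ q^-1 + T * (y `^ q - m)) by rewrite /m; ring.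
  by apply: lerD; apply: ler_wpM2l => //; lra.
rewrite -[leLHS]powRr1// -{1}(mulVf (lt0r_neq0 q0)) powRrM.
apply: ge0_ler_powR hm; rewrite ?nnegrE ?powR_ge0 ?(ltW q0)//.
by rewrite addr_ge0// mulr_ge0//; lra.
Qed.

Lemma derive_ge0_ndecr (f f' : R -> R) t :
  (forall x, 0 <= x -> x < 1 -> is_derive x 1 f (f' x)) ->
  (forall x, 0 <= x -> x < 1 -> 0 <= f' x) -> 0 <= t -> t < 1 -> f 0 <= f t.
Proof.
move=> fd f0 t0 t1; apply: (@ger0_derive1_ndecr _ f 0 t) => //.
- move=> x; rewrite in_itv/= => /andP[x0 xt].
  by have [] := fd x (ltW x0) (lt_trans xt t1).
- move=> x; rewrite in_itv/= => /andP[x0 xt].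
  have fx := fd x (ltW x0) (lt_trans xt t1).
  by rewrite derive1E derive_val f0// ?ltW// (lt_trans xt).
- apply: continuous_in_subspaceT => x; rewrite inE/= in_itv/= => /andP[x0 xt].
  have [fx _] := fd x x0 (le_lt_trans xt t1).
  exact/differentiable_continuous/derivable1_diffP.
Qed.

Lemma is_derive_powR_onePlus p x : -1 < x ->
  is_derive x 1 (fun t => (1 + t) `^ p) (p * (1 + x) `^ (p - 1)).
Proof.
move=> x1; have h1 : 0 < 1 + x by lra.
have h2 : is_derive x 1 (fun t => 1 + t) (1 : R).
  by have := is_deriveD (is_derive_cst (1 : R) x 1) (is_derive_id x 1); rewrite add0r.
have := @is_derive1_comp _ (fun y => y `^ p) (fun t => 1 + t) x _ _ (is_derive1_powR p h1) h2.
by rewrite mulr1.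
Qed.

Lemma is_derive_powR_oneMinus p x : x < 1 ->
  is_derive x 1 (fun t => (1 - t) `^ p) (- (p * (1 - x) `^ (p - 1))).
Proof.
move=> x1; have h1 : 0 < 1 - x by lra.
have h2 : is_derive x 1 (fun t => 1 - t) (-1 : R).
  by have := is_deriveB (is_derive_cst (1 : R) x 1) (is_derive_id x 1); rewrite sub0r.
have := @is_derive1_comp _ (fun y => y `^ p) (fun t => 1 - t) x _ _ (is_derive1_powR p h1) h2.
by rewrite mulrN1.
Qed.

(** The derivative of the
    difference is s (A + B - 2) with A = (1 + x)^(s - 1), B = (1 - x)^(s - 1) and
    A B = (1 - x^2)^(s - 1) >= 1, so A + B >= 2. *)
Lemma odd_part_ge s t : 0 < s -> s <= 1 -> 0 <= t -> t < 1 ->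
  2 * s * t <= (1 + t) `^ s - (1 - t) `^ s.
Proof.
move=> s0 s1 t0 t1.
pose f x := (1 + x) `^ s - (1 - x) `^ s - 2 * s * x.
pose f' x := s * (1 + x) `^ (s - 1) + s * (1 - x) `^ (s - 1) - 2 * s.
suff : f 0 <= f t by rewrite /f addr0 subr0 powR1 subrr mulr0 subr0; lra.
apply: (derive_ge0_ndecr (f' := f')) => // x x0 x1.
  have d1 := @is_derive_powR_onePlus s x ltac:(lra).
  have d2 := is_derive_powR_oneMinus s x1.
  have d3 := is_deriveZ (2 * s) (is_derive_id x (1 : R)).
  have := is_deriveB (is_deriveB d1 d2) d3.
  by rewrite opprK /GRing.scale/= mulr1.
rewrite /f' -mulrDr [2 * s]mulrC -mulrBr mulr_ge0 ?(ltW s0)// subr_ge0.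
have a0 : 0 < (1 + x) `^ (s - 1) by rewrite powR_gt0//; lra.
have b0 : 0 < (1 - x) `^ (s - 1) by rewrite powR_gt0//; lra.
have ab1 : 1 <= (1 + x) `^ (s - 1) * (1 - x) `^ (s - 1).
  rewrite -powRM; [|lra|lra].
  rewrite -[leLHS](powRr0 ((1 + x) * (1 - x))).
  by apply: ger_powR; [nra|lra].
move: a0 b0 ab1; move: (_ `^ _) (_ `^ _) => A B a0 b0 ab1.
rewrite leNgt; apply/negP => AB2.
have : 0 < (2 - (A + B)) * (2 + (A + B)) by rewrite mulr_gt0//; lra.
by have := sqr_ge0 (A - B); nra.
Qed.

Lemma even_part_ge_lt1 p t : 1 < p -> p <= 2 -> 0 <= t -> t < 1 ->
  2 + p * (p - 1) * t ^+ 2 <= (1 + t) `^ p + (1 - t) `^ p.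
Proof.
move=> p1 p2 t0 t1.
pose f x := (1 + x) `^ p + (1 - x) `^ p - p * (p - 1) * x ^+ 2.
pose f' x := p * (1 + x) `^ (p - 1) - p * (1 - x) `^ (p - 1) - p * (p - 1) * (2 * x).
suff : f 0 <= f t.
  by rewrite /f addr0 subr0 powR1 expr0n/= mulr0 subr0; lra.
apply: (derive_ge0_ndecr (f' := f')) => // x x0 x1.
  have d1 := @is_derive_powR_onePlus p x ltac:(lra).
  have d2 := is_derive_powR_oneMinus p x1.
  have d3 := is_deriveZ (p * (p - 1)) (is_deriveX 2 (is_derive_id x (1 : R))).
  have := is_deriveB (is_deriveD d1 d2) d3.
  by rewrite /GRing.scale/= mulr1 expr1.
have := @odd_part_ge (p - 1) x; rewrite /f'.
have -> : p * (1 + x) `^ (p - 1) - p * (1 - x) `^ (p - 1) - p * (p - 1) * (2 * x)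
  = p * ((1 + x) `^ (p - 1) - (1 - x) `^ (p - 1) - 2 * (p - 1) * x) by ring.
by move=> h; rewrite mulr_ge0//; [lra|rewrite subr_ge0 h//; lra].
Qed.

(** The derivative argument needs 1 - t > 0; the case t = 1 is obtained by letting
    t = 1 - d tend to 1. *)
Lemma even_part_ge p t : 1 < p -> p <= 2 -> 0 <= t -> t <= 1 ->
  2 + p * (p - 1) * t ^+ 2 <= (1 + t) `^ p + (1 - t) `^ p.
Proof.
move=> p1 p2 t0; rewrite le_eqVlt => /predU1P[->|]; last exact: even_part_ge_lt1.
rewrite expr1n mulr1 subrr powR0 ?addr0; last by rewrite gt_eqF//; lra.
apply/ler_addgt0Pr => e e0; pose d := Num.min 1 (e / 5).
have d0 : 0 < d by rewrite lt_min ltr01 divr_gt0.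
have d1 : d <= 1 by rewrite ge_min lexx.
have de : d <= e / 5 by rewrite ge_min lexx orbT.
have := @even_part_ge_lt1 p (1 - d) p1 p2.
rewrite subr_ge0 ltrBlDr ltrDl => /(_ d1 d0).
rewrite opprB [1 + (d - 1)]addrC subrK.
have k1 : d `^ p <= d by apply: ge1r_powR; [rewrite d0 d1|lra].
have k2 : (1 + (1 - d)) `^ p <= (1 + 1) `^ p.
  by apply: ge0_ler_powR; rewrite ?nnegrE; lra.
have k3 : p * (p - 1) <= 2 by nra.
have k4 : p * (p - 1) - 4 * d <= p * (p - 1) * (1 - d) ^+ 2.
  have : 0 <= p * (p - 1) by rewrite mulr_ge0; lra.
  by move: (p * (p - 1)) k3 => P; nra.
lra.
Qed.

(** The even part of (1 + t)^p dominates its Taylor polynomial of degree 2, which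
    dominates the left-hand side by Bernoulli with exponent p/2 <= 1. *)
Lemma two_point_ge p t : 1 < p -> p <= 2 -> 0 <= t -> t <= 1 ->
  2 * (1 + (p - 1) * t ^+ 2) `^ (p / 2) <= (1 + t) `^ p + (1 - t) `^ p.
Proof.
move=> p1 p2 t0 t1; apply: le_trans (even_part_ge p1 p2 t0 t1).
have := @powR_bernoulli_concave R (p / 2) ((p - 1) * t ^+ 2).
have t2 := sqr_ge0 t.
have : 0 <= (p - 1) * t ^+ 2 by rewrite mulr_ge0//; lra.
by move=> h /(_ ltac:(lra) ltac:(lra) ltac:(lra)); lra.
Qed.

Lemma powR_sqr x p : 0 <= x -> (x ^+ 2) `^ (p / 2) = x `^ p.
Proof.
by move=> x0; rewrite -powR_mulrn// -powRrM mulrC divfK.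
Qed.

Lemma two_point_homogeneous p a b : 1 < p -> p <= 2 -> 0 <= b -> b <= a ->
  2 * (a ^+ 2 + (p - 1) * b ^+ 2) `^ (p / 2) <= (a + b) `^ p + (a - b) `^ p.
Proof.
move=> p1 p2 b0 ba; have [a0|a0] := leP a 0.
  have -> : a = 0 by lra.
  have -> : b = 0 by lra.
  rewrite subrr addr0 expr0n/= mulr0 addr0 !powR0 ?gt_eqF//; lra.
have t0 : 0 <= b / a by rewrite divr_ge0// ltW.
have t1 : b / a <= 1 by rewrite ler_pdivrMr// mul1r.
have := two_point_ge p1 p2 t0 t1.
have : 0 < a `^ p by rewrite powR_gt0.
move=> /ler_pM2l <-; rewrite mulrDr mulrCA.
rewrite -{1}(powR_sqr p (ltW a0)) -!powRM ?sqr_ge0 ?(ltW a0)//; try lra.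
  have -> : a ^+ 2 * (1 + (p - 1) * (b / a) ^+ 2) = a ^+ 2 + (p - 1) * b ^+ 2.
    by field; rewrite gt_eqF.
  have -> : a * (1 + b / a) = a + b by field; rewrite gt_eqF.
  by have -> : a * (1 - b / a) = a - b by field; rewrite gt_eqF.
by rewrite addr_ge0// mulr_ge0 ?sqr_ge0//; lra.
Qed.

(** For a < b, exchanging the roles costs nothing since p - 1 <= 1. *)
Lemma two_point_nonneg p a b : 1 < p -> p <= 2 -> 0 <= a -> 0 <= b ->
  2 * (a ^+ 2 + (p - 1) * b ^+ 2) `^ (p / 2) <= (a + b) `^ p + `|a - b| `^ p.
Proof.
move=> p1 p2 a0 b0; have [ba|ab] := leP b a.
  by rewrite ger0_norm ?subr_ge0//; exact: two_point_homogeneous.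
have := two_point_homogeneous p1 p2 a0 (ltW ab).
rewrite distrC gtr0_norm ?subr_gt0// [b + a]addrC; apply: le_trans.
rewrite ler_pM2l//; apply: ge0_ler_powR; rewrite ?nnegrE; try lra.
- by rewrite addr_ge0 ?mulr_ge0 ?sqr_ge0//; lra.
- by rewrite addr_ge0 ?mulr_ge0 ?sqr_ge0//; lra.
- by have : a ^+ 2 <= b ^+ 2 by [nra]; nra.
Qed.

Lemma nc_add_sqr u v : nc (u + v) ^+ 2 =
  nc u ^+ 2 + nc v ^+ 2 + 2 * complex.Re (u * conjc v).
Proof. by rewrite !nc_sqr; case: u => a b; case: v => c d /=; ring. Qed.

Lemma nc_sub_sqr u v : nc (u - v) ^+ 2 =
  nc u ^+ 2 + nc v ^+ 2 - 2 * complex.Re (u * conjc v).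
Proof. by rewrite !nc_sqr; case: u => a b; case: v => c d /=; ring. Qed.

(** |u + v|^2 and |u - v|^2 are |u|^2 + |v|^2 +- 2 B with |B| <= |u||v|, hence
    they are convex combinations of (|u| + |v|)^2 and (|u| - |v|)^2 with opposite
    weights: concavity of x^(p/2) reduces the claim to nonnegative reals. *)
Lemma two_point_complex p u v : 1 < p -> p <= 2 ->
  2 * (nc u ^+ 2 + (p - 1) * nc v ^+ 2) `^ (p / 2) <=
  nc (u + v) `^ p + nc (u - v) `^ p.
Proof.
move=> p1 p2; have Pu := nc_add_sqr u v; have Pv := nc_sub_sqr u v.
have u0 := nc_ge0 u; have v0 := nc_ge0 v.
apply: le_trans (two_point_nonneg p1 p2 u0 v0) _.
have : `|complex.Re (u * (conjc v))| <= nc u * nc v.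
  apply: le_trans (Re_le_nc _) _; rewrite ncM.
  by rewrite (_ : nc (conjc v) = nc v)// !ncE; case: (v) => c d /=; rewrite sqrrN.
rewrite -(powR_sqr p (nc_ge0 (u + v))) -(powR_sqr p (nc_ge0 (u - v))) Pu Pv.
rewrite -(powR_sqr p (addr_ge0 u0 v0)) -(powR_sqr p (normr_ge0 _)).
rewrite real_normK ?num_real//.
set a := nc u in u0 *; set b := nc v in v0 *; set B := complex.Re _ => Bab.
have q0 : 0 < p / 2 by lra.
have q1 : p / 2 <= 1 by lra.
have [ab0|ab0] := leP (a * b) 0.
  have ab00 : a * b = 0 by have := mulr_ge0 u0 v0; lra.
  have B0 : B = 0 by apply/eqP; rewrite -normr_le0 -ab00.
  have -> : (a + b) ^+ 2 = a ^+ 2 + b ^+ 2 by rewrite sqrrD ab00 mul0rn addr0.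
  have -> : (a - b) ^+ 2 = a ^+ 2 + b ^+ 2 by rewrite sqrrB ab00 mul0rn subr0.
  by rewrite B0 mulr0 subr0 addr0.
pose l := (1 + B / (a * b)) / 2.
have : -1 <= B / (a * b) <= 1.
  by rewrite -ler_norml normrM normfV (gtr0_norm ab0) ler_pdivrMr// mul1r.
move=> /andP[lB Bl].
have l01 : 0 <= l <= 1 by rewrite /l; apply/andP; split; lra.
have l01' : 0 <= 1 - l <= 1 by move: l01 => /andP[? ?]; apply/andP; split; lra.
have h1 := powR_concave q0 q1 l01 (sqr_ge0 (a + b)) (sqr_ge0 (a - b)).
have h2 := powR_concave q0 q1 l01' (sqr_ge0 (a + b)) (sqr_ge0 (a - b)).
have /andP[an bn] : (a != 0) && (b != 0) by rewrite -negb_or -mulf_eq0 gt_eqF.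
have lE : 2 * l - 1 = B / (a * b) by rewrite /l; field; rewrite an bn.
have BE : B = (2 * l - 1) * (a * b) by rewrite lE divfK// gt_eqF.
move: h1 h2.
have -> : l * (a + b) ^+ 2 + (1 - l) * (a - b) ^+ 2 = a ^+ 2 + b ^+ 2 + 2 * B.
  by rewrite BE; ring.
have -> : (1 - l) * (a + b) ^+ 2 + (1 - (1 - l)) * (a - b) ^+ 2 =
  a ^+ 2 + b ^+ 2 - 2 * B by rewrite BE; ring.
lra.
Qed.

(** The squares satisfy the parallelogram identity, and x^(p/2) is convex and
    superadditive. *)
Lemma clarkson_complex p u v : 2 <= p ->
  2 * (nc u `^ p + nc v `^ p) <= nc (u + v) `^ p + nc (u - v) `^ p.
Proof.
move=> p2; have Pu := nc_add_sqr u v; have Pv := nc_sub_sqr u v.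
have q1 : 1 <= p / 2 by lra.
have := powR_midpoint q1 (sqr_ge0 (nc (u + v))) (sqr_ge0 (nc (u - v))).
have := powR_superadditive q1 (sqr_ge0 (nc u)) (sqr_ge0 (nc v)).
rewrite !powR_sqr ?nc_ge0//.
have -> : (nc (u + v) ^+ 2 + nc (u - v) ^+ 2) / 2 = nc u ^+ 2 + nc v ^+ 2.
  by rewrite Pu Pv; field.
lra.
Qed.

End TwoPoint.

(** * Weak parallelogram law on a circle *)

Section MeanParallelogram.
Context {R : realType}.
Implicit Types (p q r s t x y a b : R) (u v : R[i] -> R[i]).

(** As a function of X = x^q and Y = y^q, (x + y)^q = (X^(1/q) + Y^(1/q))^q is a
    norm; the two coefficients are its supporting functional at (a^q, b^q).
    Integrating the inequality and using the equality gives the reverse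
    Minkowski inequality in L^q. *)
Lemma powR_add_support q a b : 0 < q -> q <= 1 -> 0 <= a -> 0 <= b ->
  exists alpha beta : R,
    (forall x y, 0 <= x -> 0 <= y ->
       alpha * x `^ q + beta * y `^ q <= (x + y) `^ q) /\
    alpha * a `^ q + beta * b `^ q = (a + b) `^ q.
Proof.
move=> q0 q1 a0 b0.
have mono x y : 0 <= x -> x <= y -> x `^ q <= y `^ q.
  by move=> x0 xy; apply: ge0_ler_powR => //; rewrite ?nnegrE//; lra.
have [a0'|a0'] := leP a 0.
  have -> : a = 0 by lra.
  exists 0, 1; split=> [x y x0 y0|]; last by rewrite add0r mul0r mul1r add0r.
  by rewrite mul0r add0r mul1r mono// lerDr.
have [b0'|b0'] := leP b 0.
  have -> : b = 0 by lra.
  exists 1, 0; split=> [x y x0 y0|]; last by rewrite addr0 mul0r mul1r addr0.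
  by rewrite mul0r addr0 mul1r mono// lerDl.
set c := a + b; have c0 : 0 < c by rewrite /c; lra.
have l1 : 1 - a / c = b / c by rewrite /c; field; rewrite gt_eqF.
exists (a / c * (c / a) `^ q), (b / c * (c / b) `^ q); split=> [x y x0 y0|].
  have la : 0 <= a / c <= 1.
    by rewrite divr_ge0 ?(ltW c0)//= ler_pdivrMr// mul1r /c lerDl.
  have xa : 0 <= c / a * x by rewrite mulr_ge0// divr_ge0// ltW.
  have yb : 0 <= c / b * y by rewrite mulr_ge0// divr_ge0// ltW.
  have := powR_concave q0 q1 la xa yb; rewrite l1.
  rewrite (@powRM _ (c / a) x) ?(@powRM _ (c / b) y) ?divr_ge0 ?(ltW c0)//.
  rewrite !mulrA => h; apply: le_trans h _.
  rewrite le_eqVlt; apply/orP; left; apply/eqP; congr (_ `^ _).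
  by field; rewrite !gt_eqF.
have pa : (c / a) `^ q * a `^ q = c `^ q.
  by rewrite -powRM ?divr_ge0 ?(ltW c0)// divfK// gt_eqF.
have pb : (c / b) `^ q * b `^ q = c `^ q.
  by rewrite -powRM ?divr_ge0 ?(ltW c0)// divfK// gt_eqF.
by rewrite -!mulrA pa pb !mulrA -mulrDl -mulrDl divff ?gt_eqF// mul1r.
Qed.

Lemma circ_mean_lin p u v w h r (k l : R) : 0 < p ->
  holo_disk u -> holo_disk v -> holo_disk w -> holo_disk h -> 0 <= r < 1 ->
  (forall z, k * nc (u z) `^ p + l * nc (v z) `^ p <=
     nc (w z) `^ p + nc (h z) `^ p) ->
  k * circ_mean p u r + l * circ_mean p v r <= circ_mean p w r + circ_mean p h r.
Proof.
move=> p0 hu hv hw hh r01 le.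
have cont g : holo_disk g -> segcont 0 (2 * pi) (circle_power p g r).
  by move=> hg t _; exact: circle_power_continuous.
have contZ c g : holo_disk g ->
    segcont 0 (2 * pi) (fun t => c * circle_power p g r t).
  by move=> hg t tp; apply: cvgM; [exact: cvg_cst|exact: cont].
rewrite /circ_mean ![_ * (_^-1 * _)]mulrCA -!mulrDr.
rewrite ler_wpM2l ?invr_ge0 ?mulr_ge0 ?pi_ge0//.
rewrite -!segintZ -?segint_add; try by [apply: cont|apply: contZ].
apply: segint_le; last by move=> t _; exact: le.
- by move=> t tp; apply: cvgD; apply: contZ.
- by move=> t tp; apply: cvgD; apply: cont.
Qed.

Lemma circ_mean_ge0 p u r : 0 <= circ_mean p u r.
Proof.
rewrite mulr_ge0 ?invr_ge0 ?mulr_ge0 ?pi_ge0//.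
by apply: Rintegral_ge0 => t _; exact: powR_ge0.
Qed.

Lemma holo_diskD u v : holo_disk u -> holo_disk v -> holo_disk (fun z => u z + v z).
Proof.
move=> hu hv z z1; have [a ua] := hu _ z1; have [b vb] := hv _ z1.
by exists (a + b); exact: cdiffD.
Qed.

Lemma holo_diskZ c u : holo_disk u -> holo_disk (fun z => c * u z).
Proof. by move=> hu z /hu[a ua]; exists (c * a); exact: cdiffZ. Qed.

Lemma holo_disk_cst (c : R[i]) : holo_disk (fun=> c).
Proof. by move=> z _; exists 0; exact: cdiff_cst. Qed.

Lemma holo_diskB u v : holo_disk u -> holo_disk v -> holo_disk (fun z => u z - v z).
Proof.
move=> hu hv z z1; have [a ua] := hu _ z1; have [b vb] := holo_diskZ (-1) hv z1.
by exists (a + b); apply: cdiff_eq (cdiffD ua vb) => w; rewrite mulN1r.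
Qed.

Definition parallelogram_const p : R := if p <= 2 then p - 1 else 1.

Lemma parallelogram_const_gt0 p : 1 < p -> 0 < parallelogram_const p.
Proof. by rewrite /parallelogram_const; case: ifP => // _; lra. Qed.

Lemma lower_r_gt1 p : 1 < p -> 1 < lower_r p.
Proof. by rewrite /lower_r; case: ifP => // _ _; lra. Qed.

(** For p <= 2, integrate the two-point inequality after replacing its left-hand
    side by the supporting functional at
    (a, b) = (||u||^2, (p - 1) ||v||^2); this gives (a + b)^(p/2) on the left, and
    convexity of x^(2/p) turns the p-th powers on the right into squares. *)
Lemma mean_parallelogram p u v r : 1 < p -> holo_disk u -> holo_disk v ->
  0 <= r < 1 -> let M h := circ_mean p h r `^ (lower_r p / p) in
  2 * (M u + parallelogram_const p * M v) <=
  M (fun z => u z + v z) + M (fun z => u z - v z).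
Proof.
move=> p1 hu hv r01 /=; have p0 : 0 < p by lra.
have hD := holo_diskD hu hv; have hB := holo_diskB hu hv.
set Mu := circ_mean p u r; set Mv := circ_mean p v r.
set Mp := circ_mean p _ r; set Mm := circ_mean p _ r.
have Mu0 : 0 <= Mu := circ_mean_ge0 _ _ _.
have Mv0 : 0 <= Mv := circ_mean_ge0 _ _ _.
have Mp0 : 0 <= Mp := circ_mean_ge0 _ _ _.
have Mm0 : 0 <= Mm := circ_mean_ge0 _ _ _.
have lin k l : (forall z, k * nc (u z) `^ p + l * nc (v z) `^ p <=
     nc (u z + v z) `^ p + nc (u z - v z) `^ p) -> k * Mu + l * Mv <= Mp + Mm.
  exact: circ_mean_lin.
move: Mu Mv Mp Mm Mu0 Mv0 Mp0 Mm0 lin => Mu Mv Mp Mm Mu0 Mv0 Mp0 Mm0 lin.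
rewrite /lower_r /parallelogram_const; case: (leP p 2) => p2; last first.
  rewrite divff ?gt_eqF// !powRr1// mul1r mulrDr.
  apply: lin => z; rewrite -mulrDr.
  by apply: clarkson_complex; exact: ltW.
set q := p / 2; have q0 : 0 < q by rewrite /q; lra.
have q1 : q <= 1 by rewrite /q; lra.
have q'1 : 1 <= 2 / p by rewrite ler_pdivlMr// mul1r.
have qK x : 0 <= x -> (x `^ (2 / p)) `^ q = x.
  move=> x0; rewrite -powRrM (_ : 2 / p * q = 1) ?powRr1//.
  by rewrite /q; field; rewrite gt_eqF.
have qK' x : 0 <= x -> (x `^ q) `^ (2 / p) = x.
  move=> x0; rewrite -powRrM (_ : q * (2 / p) = 1) ?powRr1//.
  by rewrite /q; field; rewrite gt_eqF.
have a0 : 0 <= Mu `^ (2 / p) := powR_ge0 _ _.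
have b0 : 0 <= (p - 1) * Mv `^ (2 / p) by rewrite mulr_ge0 ?powR_ge0//; lra.
have [al [be [support touch]]] := powR_add_support q0 q1 a0 b0.
have : (Mu `^ (2 / p) + (p - 1) * Mv `^ (2 / p)) `^ q <= (Mp + Mm) / 2.
  rewrite -touch qK// powRM ?powR_ge0 ?qK//; last lra.
  rewrite ler_pdivlMr// mulrDl mulrA ![_ * 2]mulrC !mulrA.
  apply: lin => z.
  apply: le_trans (two_point_complex (u z) (v z) p1 p2).
  rewrite -!mulrA -mulrDr ler_pM2l// -!(powR_sqr _ (nc_ge0 _)) -powRM ?sqr_ge0//; last lra.
  apply: support; first exact: sqr_ge0.
  by apply: mulr_ge0; [lra|exact: sqr_ge0].
move=> h; have m0 : 0 <= (Mp + Mm) / 2 by rewrite divr_ge0// addr_ge0.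
apply: le_trans (powR_midpoint q'1 Mp0 Mm0); rewrite ler_pM2l//.
rewrite -[leLHS]qK' ?addr_ge0//.
by apply: ge0_ler_powR; rewrite ?nnegrE ?powR_ge0//; lra.
Qed.

(** With [phi t] = ||x + t y||^r and Y = ||y||^r, the law for x + (t/2) y and
    (t/2) y says that the defect d(t) = phi t - phi 0 - K t^r Y satisfies
    2 d(t/2) <= d(t); this is the equation that determines K.  By orthogonality
    d(t) >= - K t^r Y, so 2^n d(2^-n) >= - K Y / (2^(r-1))^n, which tends to 0. *)
Lemma pythagoras_of_parallelogram (phi : R -> R) r C K Y : 1 < r -> 0 <= Y ->
  0 <= K -> K * (2 `^ (r - 1) - 1) = C ->
  (forall n, phi 0 <= phi (2^-1 ^+ n)) ->
  (forall t, 0 <= t -> 2 * (phi (t / 2) + C * ((t / 2) `^ r * Y)) <= phi t + phi 0) ->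
  phi 0 + K * Y <= phi 1.
Proof.
move=> r1 Y0 K0 KC phi0 par; have r0 : 0 < r by lra.
pose d n := phi (2^-1 ^+ n) - phi 0 - K * ((2^-1 ^+ n) `^ r * Y).
have hn0 n : 0 <= (2^-1 : R) ^+ n by rewrite exprn_ge0.
have dS n : 2 * d n.+1 <= d n.
  have hS : (2^-1 : R) ^+ n.+1 = 2^-1 ^+ n / 2 by rewrite exprSr.
  have := par (2^-1 ^+ n) (hn0 n); rewrite /d -hS -KC.
  have -> : ((2^-1 : R) ^+ n) `^ r = 2 * 2 `^ (r - 1) * (2^-1 ^+ n.+1) `^ r.
    by rewrite mulr_powRB1// -powRM//; congr (_ `^ _); rewrite hS; field.
  by lra.
have d2n n : 2 ^+ n * d n <= d 0%N.
  elim: n => [|n IH]; first by rewrite expr0 mul1r.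
  by apply: le_trans IH; rewrite exprSr -mulrA ler_wpM2l// exprn_ge0.
set g := 2 `^ (r - 1).
have g1 : 1 < g.
  have rm : 0 < r - 1 by lra.
  have := gt0_ltr_powR rm; rewrite /g => /(_ 1 2).
  by rewrite !nnegrE powR1; apply; lra.
have gn n : n%:R * (g - 1) <= g ^+ n.
  elim: n => [|n IH]; first by rewrite mul0r expr0.
  have gn1 : 1 <= g ^+ n by rewrite exprn_ege1// ltW.
  rewrite exprS -natr1; nra.
have low n : - (K * Y / g ^+ n) <= d 0%N.
  apply: le_trans (d2n n); rewrite /d.
  have -> : K * Y / g ^+ n = 2 ^+ n * (K * ((2^-1 ^+ n) `^ r * Y)).
    have -> : ((2^-1 : R) ^+ n) `^ r = (2 ^+ n)^-1 / g ^+ n.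
      rewrite -powR_mulrn// powRAC powR_mulrn ?powR_ge0// -exprVn -exprVn -exprMn.
      congr (_ ^+ _); rewrite -(@mulr_powRB1 _ _ r)//; congr (_ * _).
      by rewrite /g -[2^-1]powR_inv1// -powRrM mulN1r powRN.
    by field; rewrite !expf_neq0//= gt_eqF//; lra.
  have h2 : 0 < (2 : R) ^+ n by rewrite exprn_gt0.
  by have := phi0 n; move: (2 ^+ n) h2 => P; nra.
have : 0 <= d 0%N.
  rewrite leNgt; apply/negP => d0.
  pose n := (Num.truncn (K * Y / ((g - 1) * - d 0%N))).+1.
  have := low n; rewrite lerNl leNgt => /negP; apply.
  have den : 0 < (g - 1) * - d 0%N by rewrite mulr_gt0 ?subr_gt0// oppr_gt0.
  have gn0 : 0 < g ^+ n by rewrite exprn_gt0//; lra.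
  rewrite ltr_pdivrMr//.
  have : K * Y / ((g - 1) * - d 0%N) < n%:R := truncnS_gt _.
  rewrite ltr_pdivrMr// => h; apply: lt_le_trans h _.
  by rewrite mulrA [leRHS]mulrC ler_pM2r ?oppr_gt0// gn.
by rewrite /d expr0 powR1 mul1r; lra.
Qed.

End MeanParallelogram.

(** * Passing to the Hardy norm *)

Section HardyNorm.
Context {R : realType}.
Implicit Types (p r s t x y S : R) (u v f : R[i] -> R[i]).

(** [S] is the p-th power of the Hardy norm of [u].  Stating it as a real least
    upper bound keeps extended reals out of the inequalities; the norm to the
    power r is then [S `^ (lower_r p / p)]. *)
Definition mean_sup p u S :=
  (forall r, 0 <= r < 1 -> circ_mean p u r <= S) /\
  (forall B, (forall r, 0 <= r < 1 -> circ_mean p u r <= B) -> S <= B).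

Lemma eq_mean_sup p u v S : u =1 v -> mean_sup p u S -> mean_sup p v S.
Proof. by move=> /funext ->. Qed.

Lemma mean_sup_exists p u B : (forall r, 0 <= r < 1 -> circ_mean p u r <= B) ->
  exists S, mean_sup p u S.
Proof.
move=> ub; pose X := [set circ_mean p u r | r in [set r | 0 <= r < 1]].
have X0 : X !=set0 by exists (circ_mean p u 0), 0 => //=; rewrite lexx ltr01.
have Xub : has_ubound X by exists B => _ [r r01 <-]; exact: ub.
exists (sup X); split=> [r r01|C Cub]; first by apply: ub_le_sup => //; exists r.
by apply: ge_sup => // _ [r r01 <-]; exact: Cub.
Qed.

Lemma integral_meanE p u r : 0 < p -> holo_disk u -> 0 <= r < 1 ->
  integral_mean p u r = (circ_mean p u r)%:E.
Proof.
move=> p0 hu r01; rewrite /integral_mean /circ_mean EFinM; congr (_ * _)%E.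
rewrite /segint /Rintegral fineK//; apply: integrable_fin_num => //.
by apply: segcont_integrable => t _; exact: circle_power_continuous.
Qed.

Lemma mean_sup_ereal_sup p u S : 0 < p -> holo_disk u -> mean_sup p u S ->
  ereal_sup [set integral_mean p u rho | rho in `[0, 1[%classic] = S%:E.
Proof.
move=> p0 hu [ub lub]; apply/eqP; rewrite eq_le; apply/andP; split.
  apply/ereal_supP => _ [r /= r01 <-]; move: r01; rewrite in_itv/= => r01.
  by rewrite integral_meanE// lee_fin ub.
set X := ereal_sup _.
have le r : 0 <= r < 1 -> ((circ_mean p u r)%:E <= X)%E.
  move=> r01; rewrite -integral_meanE//.
  by apply: ereal_sup_ubound; exists r; rewrite //= in_itv.
clearbody X; case: X le => [x||] le.
- by rewrite lee_fin; apply: lub => r /le; rewrite lee_fin.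
- by rewrite leey.
- by have := le 0; rewrite lexx ltr01 => /(_ isT).
Qed.

Lemma mean_sup_ehardy_norm p u S : 0 < p -> holo_disk u -> mean_sup p u S ->
  ehardy_norm p u = (S `^ p^-1)%:E.
Proof. by move=> p0 hu uS; rewrite /ehardy_norm (mean_sup_ereal_sup p0 hu uS) poweR_EFin. Qed.

Lemma hardy_space_mean_sup p u : 0 < p -> hardy_space p u ->
  holo_disk u /\ exists S, mean_sup p u S.
Proof.
move=> p0 [hu nu]; have {}hu : holo_disk u.
  by move=> z z1; apply/derivable_cdiff/hu; rewrite norm_nc ltcR.
split => //; move: nu; rewrite /ehardy_norm; set X := ereal_sup _.
have le r : 0 <= r < 1 -> ((circ_mean p u r)%:E <= X)%E.
  move=> r01; rewrite -integral_meanE//.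
  by apply: ereal_sup_ubound; exists r; rewrite //= in_itv.
clearbody X; case: X le => [x||] le.
- by move=> _; apply: (@mean_sup_exists _ _ x) => r /le; rewrite lee_fin.
- by rewrite poweRyr// invr_neq0// gt_eqF.
- by have := le 0; rewrite lexx ltr01 => /(_ isT).
Qed.

Lemma mean_sup_ge0 p u S : mean_sup p u S -> 0 <= S.
Proof.
move=> [ub _]; apply: le_trans (circ_mean_ge0 p u 0) (ub _ _).
by rewrite lexx ltr01.
Qed.

Lemma mean_sup_powR_le p u S s B : 0 < s -> mean_sup p u S ->
  (forall r, 0 <= r < 1 -> circ_mean p u r `^ s <= B) -> S `^ s <= B.
Proof.
move=> s0 uS le; have S0 := mean_sup_ge0 uS; case: uS => _ lub.
have B0 : 0 <= B by apply: le_trans (powR_ge0 _ _) (le 0 _); rewrite lexx ltr01.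
have inv x : 0 <= x -> (x `^ s) `^ s^-1 = x.
  by move=> x0; rewrite -powRrM divff ?gt_eqF// powRr1.
have inv' x : 0 <= x -> (x `^ s^-1) `^ s = x.
  by move=> x0; rewrite -powRrM mulVf ?gt_eqF// powRr1.
rewrite -(inv' _ B0).
apply: ge0_ler_powR; rewrite ?nnegrE ?powR_ge0 ?(ltW s0)//.
apply: lub => r r01; rewrite -[leLHS]inv ?circ_mean_ge0//.
by apply: ge0_ler_powR; rewrite ?nnegrE ?powR_ge0 ?invr_ge0 ?(ltW s0) ?le.
Qed.

(** The radii realising the suprema for [u] and [v] may differ; monotonicity of
    the circular means moves both to the larger one. *)
Lemma hardy_parallelogram p u v Su Sv Sp Sm : 1 < p ->
  holo_disk u -> holo_disk v -> mean_sup p u Su -> mean_sup p v Sv ->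
  mean_sup p (fun z => u z + v z) Sp -> mean_sup p (fun z => u z - v z) Sm ->
  2 * (Su `^ (lower_r p / p) + parallelogram_const p * Sv `^ (lower_r p / p)) <=
  Sp `^ (lower_r p / p) + Sm `^ (lower_r p / p).
Proof.
move=> p1 hu hv uS vS pS mS; set s := lower_r p / p; have p0 : 0 < p by lra.
have s0 : 0 < s by rewrite /s divr_gt0//; have := lower_r_gt1 p1; lra.
set C := parallelogram_const p; have C0 : 0 < C := parallelogram_const_gt0 p1.
have mono x y : 0 <= x -> x <= y -> x `^ s <= y `^ s.
  by move=> x0 xy; apply: ge0_ler_powR => //; rewrite ?nnegrE ?(ltW s0)//; lra.
set T := Sp `^ s + Sm `^ s.
have key r1 r2 : 0 <= r1 < 1 -> 0 <= r2 < 1 ->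
    2 * (circ_mean p u r1 `^ s + C * circ_mean p v r2 `^ s) <= T.
  move=> /andP[r10 r11] /andP[r20 r21]; pose r := Num.max r1 r2.
  have r01 : 0 <= r < 1 by rewrite le_max r10 /= gt_max r11 r21.
  have rlt : r < 1 by case/andP: r01.
  have le1 : circ_mean p u r1 `^ s <= circ_mean p u r `^ s.
    apply: mono (circ_mean_ge0 _ _ _) _.
    by apply: circ_mean_le => //; rewrite /r le_max lexx.
  have le2 : circ_mean p v r2 `^ s <= circ_mean p v r `^ s.
    apply: mono (circ_mean_ge0 _ _ _) _.
    by apply: circ_mean_le => //; rewrite /r le_max lexx orbT.
  have incr (a b a' b' : R) : a <= a' -> b <= b' ->
      2 * (a + C * b) <= 2 * (a' + C * b').
    by move=> aa bb; rewrite ler_pM2l// lerD// ler_pM2l.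
  apply: le_trans (incr _ _ _ _ le1 le2) _.
  apply: le_trans (mean_parallelogram p1 hu hv r01) _.
  by apply: lerD; apply: mono (circ_mean_ge0 _ _ _) _; [apply pS|apply mS].
suff : Su `^ s <= T / 2 - C * Sv `^ s by lra.
apply: (mean_sup_powR_le s0 uS) => r1 r101.
suff : Sv `^ s <= (T / 2 - circ_mean p u r1 `^ s) / C.
  by rewrite ler_pdivlMr// mulrC; lra.
apply: (mean_sup_powR_le s0 vS) => r2 r201.
have solve (A B : R) : 2 * (A + C * B) <= T -> B <= (T / 2 - A) / C.
  by move=> h; rewrite ler_pdivlMr// mulrC; lra.
exact: solve (key _ _ r101 r201).
Qed.

Lemma circ_mean_cst p (c : R[i]) r : circ_mean p (fun=> c) r = nc c `^ p.
Proof.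
rewrite /circ_mean segint_cst ?mulr_ge0 ?pi_ge0// subr0 mulrCA mulVf ?mulr1//.
by rewrite mulf_neq0// gt_eqF// pi_gt0.
Qed.

Lemma circ_mean_at0 p u : circ_mean p u 0 = nc (u 0) `^ p.
Proof.
transitivity (circ_mean p (fun=> u 0) 0); last exact: circ_mean_cst.
apply: (congr1 (fun x => (2 * pi)^-1 * x)).
by apply: eq_segint => t _; rewrite /circle_power mul0r.
Qed.

Lemma circ_meanZ p (c : R[i]) u r : 0 < p -> holo_disk u -> 0 <= r < 1 ->
  circ_mean p (fun z => c * u z) r = nc c `^ p * circ_mean p u r.
Proof.
move=> p0 hu r01; rewrite /circ_mean mulrCA; congr (_ * _).
rewrite -segintZ; last by move=> t _; exact: circle_power_continuous.
by apply: eq_segint => t _; rewrite /circle_power ncM powRM ?nc_ge0.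
Qed.

Lemma mean_sup_cst p c : mean_sup p (fun=> c) (nc c `^ p).
Proof.
split=> [r _|B /(_ 0)]; first by rewrite circ_mean_cst.
by rewrite circ_mean_cst lexx ltr01; exact.
Qed.

Lemma mean_sup_ge_center p u S : mean_sup p u S -> nc (u 0) `^ p <= S.
Proof. by move=> [ub _]; rewrite -circ_mean_at0; apply: ub; rewrite lexx ltr01. Qed.

Lemma mean_sup_unique p u S T : mean_sup p u S -> mean_sup p u T -> S = T.
Proof.
by move=> [uS lS] [uT lT]; apply/eqP; rewrite eq_le lS// lT.
Qed.

Lemma mean_supZ p c u S : 0 < p -> holo_disk u -> mean_sup p u S ->
  mean_sup p (fun z => c * u z) (nc c `^ p * S).
Proof.
move=> p0 hu uS; have S0 := mean_sup_ge0 uS; case: uS => ub lub.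
split=> [r r01|B Bub].
  by rewrite circ_meanZ// ler_wpM2l ?powR_ge0// ub.
have c0 := powR_ge0 (nc c) p.
have [c0'|c0'] := leP (nc c `^ p) 0.
  have -> : nc c `^ p = 0 by lra.
  rewrite mul0r; apply: le_trans (circ_mean_ge0 p (fun z => c * u z) 0) (Bub _ _).
  by rewrite lexx ltr01.
rewrite mulrC -ler_pdivlMr//; apply: lub => r r01.
by rewrite ler_pdivlMr// mulrC -circ_meanZ// Bub.
Qed.

Lemma mean_supD p u v Su Sv : 1 < p -> holo_disk u -> holo_disk v ->
  mean_sup p u Su -> mean_sup p v Sv -> exists S, mean_sup p (fun z => u z + v z) S.
Proof.
move=> p1 hu hv [uS _] [vS _]; have p0 : 0 < p by lra.
have hD := holo_diskD hu hv.
apply: (@mean_sup_exists _ _ (2 `^ (p - 1) * (Su + Sv))) => r r01.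
have h0 := @holo_disk_cst R 0.
have k0 : 0 < 2 `^ (p - 1) :> R by rewrite powR_gt0.
have := @circ_mean_lin R p (fun z => u z + v z) (fun=> 0) u v r
  (2 `^ (p - 1))^-1 0 p0 hD h0 hu hv r01.
rewrite [0 * circ_mean _ _ _]mul0r addr0 ler_pdivrMl// => h.
apply: le_trans (h _) _ => [z|]; last first.
  by rewrite ler_pM2l//; apply: lerD; [exact: uS|exact: vS].
rewrite mul0r addr0 ler_pdivrMl//.
have x0 := nc_ge0 (u z); have y0 := nc_ge0 (v z).
apply: (@le_trans _ _ ((nc (u z) + nc (v z)) `^ p)).
  apply: ge0_ler_powR; rewrite ?nnegrE ?nc_ge0 ?addr_ge0 ?(ltW p0)//.
  exact: nc_add.
have := powR_midpoint (ltW p1) x0 y0.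
rewrite -(ler_pM2l k0); apply: le_trans.
rewrite mulrA [_ * 2]mulrC mulr_powRB1// -powRM ?divr_ge0 ?addr_ge0//.
by rewrite mulrC divfK.
Qed.

Lemma lower_K1E p : 1 < p ->
  lower_K1 p * (2 `^ (lower_r p - 1) - 1) = parallelogram_const p.
Proof.
rewrite /lower_K1 /lower_r /parallelogram_const => p1; case: (leP p 2) => p2.
  have -> : 2 - 1 = 1 :> R by ring.
  by rewrite powRr1// (_ : 2 - 1 = 1 :> R) ?mulr1//; ring.
rewrite mulVf// subr_eq0 gt_eqF//.
have rm : 0 < p - 1 by lra.
have := gt0_ltr_powR rm => /(_ 1 2).
by rewrite !nnegrE powR1; apply; lra.
Qed.

Lemma lower_K1_gt0 p : 1 < p -> 0 < lower_K1 p.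
Proof.
move=> p1; have := lower_K1E p1; have := parallelogram_const_gt0 p1.
have : 0 < 2 `^ (lower_r p - 1) - 1 :> R.
  have rm : 0 < lower_r p - 1 by have := lower_r_gt1 p1; lra.
  have := gt0_ltr_powR rm => /(_ 1 2).
  by rewrite !nnegrE powR1 subr_gt0; apply; lra.
by move=> g0 c0 e; rewrite -(pmulr_lgt0 _ g0) e.
Qed.

(** The law is used along the segment from [u] to [u + v], whose points u + t v
    all have finite norm. *)
Lemma hardy_pythagoras p u v Su Sv S : 1 < p -> holo_disk u -> holo_disk v ->
  mean_sup p u Su -> mean_sup p v Sv -> mean_sup p (fun z => u z + v z) S ->
  (forall (c : R[i]) T, mean_sup p (fun z => u z + c * v z) T -> Su <= T) ->
  Su `^ (lower_r p / p) + lower_K1 p * Sv `^ (lower_r p / p) <=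
  S `^ (lower_r p / p).
Proof.
move=> p1 hu hv uS vS uvS orth; set s := lower_r p / p; have p0 : 0 < p by lra.
have s0 : 0 < s by rewrite /s divr_gt0//; have := lower_r_gt1 p1; lra.
have ps : p * s = lower_r p by rewrite /s mulrC divfK// gt_eqF.
have hZ t := holo_diskZ t%:C hv.
have /choice[N NP] : forall t : R, exists T, mean_sup p (fun z => u z + t%:C * v z) T.
  by move=> t; apply: mean_supD p1 hu (hZ t) uS (mean_supZ _ p0 hv vS).
have N0 : N 0 = Su.
  by apply: mean_sup_unique (NP 0) (eq_mean_sup _ uS) => z; rewrite mul0r addr0.
have N1 : N 1 = S.
  by apply: mean_sup_unique (NP 1) (eq_mean_sup _ uvS) => z; rewrite mul1r.
rewrite -N0 -N1.
apply: (pythagoras_of_parallelogram (phi := fun t => N t `^ s) (lower_r_gt1 p1)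
  (powR_ge0 _ _) (ltW (lower_K1_gt0 p1)) (lower_K1E p1)).
  move=> n; apply: ge0_ler_powR; rewrite ?nnegrE ?(ltW s0) ?(mean_sup_ge0 (NP _))//.
  by rewrite N0; apply: orth (NP _).
move=> t t0.
have -> : (t / 2) `^ lower_r p * Sv `^ s = (nc (t / 2)%:C `^ p * Sv) `^ s.
  rewrite nc_real ger0_norm ?divr_ge0//.
  by rewrite (powRM _ (powR_ge0 _ _) (mean_sup_ge0 vS)) -powRrM ps.
apply: hardy_parallelogram p1 (holo_diskD hu (hZ (t / 2))) (hZ (t / 2)) (NP _)
  (mean_supZ _ p0 hv vS) _ _.
- apply: eq_mean_sup (NP t) => z.
  by rewrite -addrA -mulrDl -rmorphD/= -splitr.
- by apply: eq_mean_sup (NP 0) => z; rewrite mul0r addr0 addrK.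
Qed.

(** Bernoulli for x <= 1; for x > 1 the right-hand side exceeds 1. *)
Lemma one_sub_powR_le r x : 1 < r -> 0 <= x -> 1 - `|1 - x| `^ r <= r * x.
Proof.
move=> r1 x0; have [x1|x1] := leP x 1.
  have := @powR_bernoulli R r (- x) r1; rewrite subr_ge0 => /(_ x1).
  by rewrite ger0_norm ?subr_ge0//; lra.
by have := powR_ge0 `|1 - x| r; nra.
Qed.

End HardyNorm.

(** * The bound on the optimal constant *)

Lemma powR_inv_le (R : realType) (p x y : R) : 0 < p -> 0 <= x -> 0 <= y ->
  x `^ p^-1 <= y `^ p^-1 -> x <= y.
Proof.
move=> p0 x0 y0 xy.
have inv t : 0 <= t -> (t `^ p^-1) `^ p = t.
  by move=> t0; rewrite -powRrM mulVf ?gt_eqF// powRr1.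
rewrite -[leLHS](inv _ x0) -[leRHS](inv _ y0).
by apply: ge0_ler_powR xy; rewrite ?nnegrE ?powR_ge0// ltW.
Qed.

Lemma pythagorean_bound (R : realType) (r K l m c F G E : R) : 1 < r -> 0 < K ->
  0 <= l -> 0 <= m -> 0 <= G -> 0 < F -> `|1 - l * m| <= c ->
  c `^ r + K * (l `^ r * G) <= E -> E + K * (l `^ r * F) <= 1 ->
  l `^ (r - 1) <= r * m / (K * G + K * F).
Proof.
move=> r1 K0 l0 m0 G0 F0 lmc inner outer; have r0 : 0 < r by lra.
have lm0 : 0 <= l * m by rewrite mulr_ge0.
have bern := one_sub_powR_le r1 lm0.
have c0 := le_trans (normr_ge0 _) lmc.
have cr : `|1 - l * m| `^ r <= c `^ r.
  by apply: ge0_ler_powR lmc; rewrite ?nnegrE ?(ltW r0).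
have den : 0 < K * G + K * F by rewrite -mulrDr mulr_gt0// ltr_wpDl.
rewrite ler_pdivlMr//; have [l0'|lpos] := leP l 0.
  have -> : l = 0 by lra.
  by rewrite powR0 ?mul0r ?mulr_ge0 ?(ltW r0)// gt_eqF// subr_gt0.
rewrite -(ler_pM2l lpos) mulrA (mulr_powRB1 l0 r0).
by lra.
Qed.

Theorem proposition3p7 (R : realType) (p : R) (f : R[i] -> R[i])
    (lambda : R[i]) (hp : 1 < p) (hf : hardy_space p f) (hf0 : f 0 != 0)
    (hlambda : is_opa 0 p f lambda%:P) :
  let r := lower_r p in
  let K1 := lower_K1 p in
  (Normc.normc lambda) `^ (r - 1) <=
    r * Normc.normc (f 0) /
    (K1 * (hardy_norm p (fun z => f z - f 0)) `^ r
     + K1 * (hardy_norm p f) `^ r).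
Proof.
cbv zeta; set r := lower_r p; set K1 := lower_K1 p.
have p0 : 0 < p by lra.
have r1 : 1 < r := lower_r_gt1 hp.
have K10 : 0 < K1 := lower_K1_gt0 hp.
have [hF [S0 fS]] := hardy_space_mean_sup p0 hf.
have hZ (c : R[i]) := holo_diskZ c hF.
have hC (c : R[i]) := holo_disk_cst c.
have /choice[N NP] : forall ab : R[i] * R[i], exists T,
    mean_sup p (fun z => ab.1 + ab.2 * f z) T.
  by move=> ab; exact: mean_supD hp (hC _) (hZ _) (mean_sup_cst _ _) (mean_supZ _ p0 hF fS).
set s := r / p; have s0 : 0 < s by rewrite divr_gt0//; lra.
have ps : p * s = r by rewrite /s mulrC divfK// gt_eqF.
have norm_r u S : holo_disk u -> mean_sup p u S -> hardy_norm p u `^ r = S `^ s.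
  move=> hu uS; rewrite /hardy_norm (mean_sup_ehardy_norm p0 hu uS) /= -powRrM.
  by rewrite mulrC.
have hG : holo_disk (fun z => f z - f 0) by apply: holo_diskB hF (hC _).
have gS : mean_sup p (fun z => f z - f 0) (N (- f 0, 1)).
  by apply: eq_mean_sup (NP (- f 0, 1)) => z /=; rewrite mul1r addrC.
set F := S0 `^ s; set G := N (- f 0, 1) `^ s; set l := Normc.normc lambda.
have denE := f_equal2 (fun x y => K1 * x + K1 * y)
  (norm_r _ _ hG gS : _ = G) (norm_r _ _ hF fS : _ = F).
apply: (eq_ind_r (fun d => l `^ (r - 1) <= r * nc (f 0) / d) _ denE).
have l0 : 0 <= l := nc_ge0 _.
have F0 : 0 < F.
  rewrite powR_gt0//; apply: lt_le_trans (mean_sup_ge_center fS).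
  by rewrite powR_gt0// nc_gt0.
have G0 : 0 <= G := powR_ge0 _ _.
have scale (c : R[i]) S : 0 <= S -> (nc c `^ p * S) `^ s = nc c `^ r * S `^ s.
  by move=> S1; rewrite (powRM _ (powR_ge0 _ _) S1) -powRrM ps.
set E := N (1, - lambda).
(* 1 - lambda f is orthogonal to lambda f: adding c lambda f to it gives
   1 - mu f with mu = lambda (1 - c), which competes with lambda *)
have outer : E `^ s + K1 * (l `^ r * F) <= 1.
  have := @hardy_pythagoras R p (fun z => 1 - lambda * f z)
    (fun z => lambda * f z) E (l `^ p * S0) 1 hp.
  rewrite -/s -/K1 (scale lambda _ (mean_sup_ge0 fS)) powR1; apply.
  - exact: holo_diskB (hC _) (hZ _).
  - exact: hZ.
  - by apply: eq_mean_sup (NP (1, - lambda)) => z /=; rewrite mulNr.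
  - exact: mean_supZ.
  - have := @mean_sup_cst R p 1; rewrite nc1 powR1.
    by apply: eq_mean_sup => z; rewrite subrK.
  move=> c T cT; have [_ /(_ (lambda * (1 - c))%:P)] := hlambda.
  have err (mu : R[i]) S : mean_sup p (fun z => 1 - mu * f z) S ->
      opa_error p f mu%:P = (S `^ p^-1)%:E.
    move=> muS; rewrite /opa_error -(mean_sup_ehardy_norm p0 _ muS); last first.
      exact: holo_diskB (hC _) (hZ _).
    by congr (ehardy_norm p _); apply/funext => z; rewrite hornerC.
  rewrite (err lambda E); last first.
    by apply: eq_mean_sup (NP (1, - lambda)) => z /=; rewrite mulNr.
  rewrite (err _ T); last by apply: eq_mean_sup cT => z; ring.
  rewrite /polys_upto /= size_polyC => /(_ (leq_b1 _)); rewrite lee_fin => ET.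
  have E0 : 0 <= E := mean_sup_ge0 (NP _).
  have T0 : 0 <= T := mean_sup_ge0 cT.
  exact: powR_inv_le p0 E0 T0 ET.
(* constants are orthogonal to functions vanishing at 0, by comparison with the
   circle of radius 0 *)
have inner : nc (1 - lambda * f 0) `^ r + K1 * (l `^ r * G) <= E `^ s.
  have := @hardy_pythagoras R p (fun=> 1 - lambda * f 0)
    (fun z => - lambda * (f z - f 0)) (nc (1 - lambda * f 0) `^ p)
    (nc (- lambda) `^ p * N (- f 0, 1)) E hp.
  rewrite -/s -/K1 (scale _ _ (mean_sup_ge0 (NP _))) nc_opp -powRrM ps; apply.
  - exact: hC.
  - exact: holo_diskZ.
  - exact: mean_sup_cst.
  - by have := mean_supZ (- lambda) p0 hG gS; rewrite nc_opp.
  - by apply: eq_mean_sup (NP (1, - lambda)) => z /=; ring.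
  move=> c T /mean_sup_ge_center; rewrite subrr !mulr0 addr0; exact.
apply: pythagorean_bound r1 K10 l0 (nc_ge0 _) G0 F0 _ inner outer.
by have := nc_dist (1 : R[i]) (lambda * f 0); rewrite nc1 ncM.
Qed.
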